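(* Let $\tilde W$ be the Coxeter group with finite set of simple reflections $\tilde S$ and Coxeter matrix $(m_{s,s'})$, and let $\tau:\tilde W\to\tilde W$ be a group automorphism with $\tau(\tilde S)=\tilde S$. Let $S$ be the set of $\tau$-orbits $I$ on $\tilde S$ such that the subgroup $\tilde W_I$ generated by $I$ is finite; for $I\in S$ let $w_0^I$ be the longest element of $\tilde W_I$. Let $W'$ be the Coxeter group with generators $g_I$ ($I\in S$) and relations $(g_Ig_{I'})^{M_{I,I'}}=1$ for all $I,I'\in S$ with $M_{I,I'}<\infty$, where $M_{I,I'}$ is defined in the context. Then the map $g_I\mapsto w_0^I$ ($I\in S$) extends uniquely to a group homomorphism $\lambda:W'\to\tilde W$, and $\lambda$ is an isomorphism of $W'$ onto the subgroup $W=\{w\in\tilde W:\tau(w)=w\}$ of $\tilde W$.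
   Context: For $I,I'\in S$ define $M_{I,I'}\in\mathbf Z_{>0}\cup\{\infty\}$ as follows. If $I=I'$, $M_{I,I'}=1$. If $\tilde W_{I\cup I'}$ (the subgroup generated by $I\cup I'$) is infinite, $M_{I,I'}=\infty$. Now let $I\ne I'$ with $\tilde W_{I\cup I'}$ finite, and set $m=\max\{m_{s,s'}:s,s'\in I\}$, $m'=\max\{m_{s,s'}:s,s'\in I'\}$, $\mu=\max\{m_{s,s'}:s\in I,s'\in I'\}$. If $\mu\ge3$ then it is known that, after possibly interchanging $I$ and $I'$, there exist $p\in\{1,2,3\}$ (with $p=1$ if $\mu>3$) and a $p$-to-one surjection $u:I\to I'$ commuting with $\tau$ such that, for $s\in I,s'\in I'$, $m_{s,s'}=\mu$ if $s'=u(s)$ and $m_{s,s'}=2$ if $s'\ne u(s)$; moreover, if $p\in\{2,3\}$ then $m\le 2,m'\le2$; if $p=1$ and $\mu\ge 4$ then $m\le2,m'\le2$; if $p=1$ and $\mu=3$ then (up to interchange) $(m,m')$ is $(4,2)$, $(3,2)$, $(2,2)$ or $(1,1)$. Then: - if $\mu=2$, $M_{I,I'}=2$; - if $\mu=3$ and $p\in\{2,3\}$, $M_{I,I'}=2p$; - if $\mu=3$, $p=1$ and $(m,m')\in\{(4,2),(2,4)\}$, $M_{I,I'}=8$; - if $\mu=3$, $p=1$ and $(m,m')\in\{(3,2),(2,3)\}$, $M_{I,I'}=4$; - if $\mu\ge3$, $p=1$ and $m\le2,m'\le2$, $M_{I,I'}=\mu$. *)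

(* Defs.v *)
From HB Require Import structures.
From mathcomp Require Import all_boot.
From mathcomp Require Import all_classical.

Set Implicit Arguments.
Unset Strict Implicit.
Unset Printing Implicit Defensive.

Local Open Scope classical_set_scope.
Local Open Scope group_scope.

(* A Coxeter matrix is a function m : T -> T -> nat in which the value 0 stands
   for infinity.  Since x ^+ 0 = 1, the relation (s t)^(m s t) = 1 is then void
   exactly when m s t is infinite. *)
Definition coxeter_matrix (T : finType) (m : T -> T -> nat) : Prop :=
  [/\ forall s, m s s = 1%N,
      forall s t, m s t = m t s &
      forall s t, s != t -> m s t != 1%N].

Definition coxeter_relations (T : finType) (m : T -> T -> nat)
    (G : groupType) (f : T -> G) : Prop :=
  forall s t, (f s * f t) ^+ m s t = 1.

(* The group W is presented by the generators r s (s : T), subject to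
   the relations (r s * r t)^(m s t) = 1; the case s = t gives (r s)^2 = 1. *)
Definition coxeter_group (T : finType) (m : T -> T -> nat)
    (W : groupType) (r : T -> W) : Prop :=
  coxeter_relations m r /\
  forall (G : groupType) (f : T -> G), coxeter_relations m f ->
    exists phi : {multiplicative W -> G},
      (forall s, phi (r s) = f s) /\
      (forall psi : {multiplicative W -> G},
         (forall s, psi (r s) = f s) -> psi =1 phi).

Section CoxeterGroup.
Variables (T : finType) (W : groupType) (r : T -> W).

Definition is_subgroup (H : set W) : Prop :=
  H 1 /\ forall x y, H x -> H y -> H (x * y^-1).

Definition parabolic (I : {set T}) : set W :=
  smallest is_subgroup [set r s | s in [set` I]].

Definition is_length (w : W) (n : nat) : Prop :=
  (exists2 c : seq T, size c = n & \prod_(s <- c) r s = w) /\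
  (forall c : seq T, \prod_(s <- c) r s = w -> (n <= size c)%N).

Definition cox_length (w : W) : nat := xget 0%N [set n | is_length w n].

Definition is_longest (I : {set T}) (w : W) : Prop :=
  parabolic I w /\
  forall v, parabolic I v -> (cox_length v <= cox_length w)%N.

Definition longest (I : {set T}) : W := xget 1 [set w | is_longest I w].

Variable tau : {multiplicative W -> W}.

(* As T is finite and tau permutes the simple reflections, forward iterates
   of tau already exhaust the orbit. *)
Definition tau_orbit (s : T) : {set T} :=
  [set t | `[< exists n, iter n tau (r s) = r t >]].

Definition finite_orbit (I : {set T}) : bool :=
  [exists s, I == tau_orbit s] && `[< finite_set (parabolic I) >].

Definition folded_node := {I : {set T} | finite_orbit I}.

Variable m : T -> T -> nat.

(* Only used below when the parabolic subgroup generated by I and J is finite,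
   in which case none of the entries involved is infinite (that is, 0). *)
Definition max_entry (I J : {set T}) : nat :=
  (\max_(s in I) \max_(t in J) m s t)%N.

Definition is_folding (p : nat) (I J : {set T}) : Prop :=
  exists u : T -> T,
    [/\ u @: I = J,
        forall t, t \in J -> #|[set s in I | u s == t]| = p,
        forall s s', s \in I -> s' \in I ->
          tau (r s) = r s' -> tau (r (u s)) = r (u s') &
        forall s t, s \in I -> t \in J ->
          m s t = if t == u s then max_entry I J else 2%N].

Definition folding (p : nat) (I J : {set T}) : bool :=
  `[< is_folding p I J \/ is_folding p J I >].

(* The value 0 means infinity, as for m.  The last branch is never
   reached when m is the Coxeter matrix of W and tau is an automorphism of W
   permuting the simple reflections. *)
Definition folded_matrix (I J : folded_node) : nat :=
  let mI := max_entry (val I) (val I) in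
  let mJ := max_entry (val J) (val J) in
  let mu := max_entry (val I) (val J) in
  let fold p := folding p (val I) (val J) in
  if I == J then 1%N
  else if ~~ `[< finite_set (parabolic (val I :|: val J)) >] then 0%N
  else if mu == 2%N then 2%N
  else if (mu == 3) && fold 2%N then (2 * 2)%N
  else if (mu == 3) && fold 3%N then (2 * 3)%N
  else if [&& mu == 3, fold 1%N & (mI, mJ) \in [:: (4, 2); (2, 4)]]%N then 8%N
  else if [&& mu == 3, fold 1%N & (mI, mJ) \in [:: (3, 2); (2, 3)]]%N then 4%N
  else if [&& 3 <= mu, fold 1, mI <= 2 & mJ <= 2]%N then mu
  else 0%N.

End CoxeterGroup.

(* Main.v *)
(** The proof runs in the geometric representation of W on functions T -> R,
    with the form - cos(pi / m s t), where w sends the simple root s to a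
    nonnegative or a nonpositive vector according to l(w s) > l(w) or not.

    Injectivity of lambda is a word argument: if I is contained in the left
    descent set of a fixed element w, then w = w_I (w_I w) with additive lengths.
    Two length-additive words for w starting with I and J have I and J among the
    left descents of w, so W_(I u J) is finite with longest element
    w_I w_J w_I ... = w_J w_I w_J ... (M factors on both sides), and induction on
    the length shows that the words agree in W'.

    The number M of factors is read off the plane of tau-fixed vectors spanned
    by the sums A and D of the simple roots of I and J.  There w_I and w_J act as
    reflections in A and D, at an angle pi / M with
      cos^2 (pi / M) = B(A, D)^2 / (B(A, A) B(D, D)),
    and an element of W_(I u J) fixed by tau that fixes A and D is trivial.
    Finiteness of W_(I u J) forces B(A, A) > 0, B(D, D) > 0 and
    B(A, D)^2 < B(A, A) B(D, D); with cos(pi / m) >= 1/2 for m >= 3 these three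
    inequalities leave only the cases listed in the definition of M. *)

Require Import Defs.
From HB Require Import structures.
From mathcomp Require Import all_boot.
From mathcomp Require Import all_classical.
From mathcomp Require Import order ssralg ssrnum interval ring lra zify.
From mathcomp Require Import Rstruct reals trigo.

Set Implicit Arguments.
Unset Strict Implicit.
Unset Printing Implicit Defensive.

Local Open Scope group_scope.

(** * Cosines of Coxeter labels *)

Section CosineOfCoxeterLabels.
Import Order.TTheory GRing.Theory Num.Theory.
Local Open Scope ring_scope.
Variable R : realType.

(* As x / 0 = 0, the label 0 (infinity) gives cos 0 = 1, which is the usual
   convention of the geometric representation. *)
Definition cosl (n : nat) : R := cos (pi / n%:R).

Lemma cosl0 : cosl 0 = 1.
Proof. by rewrite /cosl invr0 mulr0 cos0. Qed.

Lemma cosl1 : cosl 1 = -1.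
Proof. by rewrite /cosl divr1 cospi. Qed.

Lemma cosl2 : cosl 2 = 0.
Proof. by rewrite /cosl cos_pihalf. Qed.

Lemma angle_itv n : 0 <= (pi / n%:R : R) <= pi.
Proof.
have p0 := pi_ge0 R; rewrite divr_ge0 ?ler0n //=; case: n => [|n].
  by rewrite invr0 mulr0.
by rewrite ler_pdivrMr ?ltr0n // ler_peMr // ler1n.
Qed.

Lemma cosl_mono a b : (0 < a)%N -> (a <= b)%N -> cosl a <= cosl b.
Proof.
move=> a0 ab; rewrite /cosl.
have b0 : (0 < b)%N by apply: leq_trans ab.
have h : pi / b%:R <= pi / a%:R :> R.
  by rewrite ler_wpM2l ?pi_ge0 // lef_pV2 ?posrE ?ltr0n // ler_nat.
have := h; rewrite le_eqVlt => /predU1P[->//|lt]; apply: ltW.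
by rewrite ltr_cos // in_itv /=; exact: angle_itv.
Qed.

Lemma cosl_ge0 n : n != 1 -> 0 <= cosl n.
Proof.
case: n => [|[|n]] // _; first by rewrite cosl0.
by rewrite -cosl2; apply: cosl_mono.
Qed.

Lemma cosl_double n : (0 < n)%N -> cosl n = 2 * cosl (2 * n) ^+ 2 - 1.
Proof.
move=> n0; rewrite /cosl.
have -> : pi / n%:R = (pi / (2 * n)%N%:R) *+ 2 :> R.
  rewrite natrM mulr2n; field.
  by rewrite pnatr_eq0 -lt0n n0.
by rewrite cos_mulr2n mulr2n; ring.
Qed.

Lemma cosl3 : cosl 3 = 1/2.
Proof.
have g := @cosl_ge0 3 isT.
suff: cos ((pi / 3%:R) *+ 2) = - cosl 3 :> R.
  rewrite cos_mulr2n -/(cosl 3) mulr2n => e.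
  have : (2 * cosl 3 - 1) * (cosl 3 + 1) = 0 by lra.
  move/eqP; rewrite mulf_eq0 => /orP[]/eqP; lra.
have -> : (pi / 3%:R) *+ 2 = pi - pi / 3%:R :> R.
  by rewrite mulr2n; lra.
by rewrite cosB cospi sinpi /cosl; lra.
Qed.

(** The label 0 is included and has cosine 1, so every edge of the Coxeter graph, finite or
    infinite, contributes at least 1/2. *)
Lemma cosl_ge_half n : n != 1 -> n != 2 -> 1/2 <= cosl n.
Proof.
case: n => [|[|[|n]]] // _ _; first by rewrite cosl0; lra.
by rewrite -cosl3; apply: cosl_mono.
Qed.

Lemma cosl4 : cosl 4 ^+ 2 = 1/2.
Proof. by have := @cosl_double 2 isT; rewrite cosl2; lra. Qed.

Lemma cosl6 : cosl 6 ^+ 2 = 3/4.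
Proof. by have := @cosl_double 3 isT; rewrite cosl3; lra. Qed.

Lemma cosl8 : cosl 8 ^+ 2 = (1 + cosl 4) / 2.
Proof. by have := @cosl_double 4 isT; lra. Qed.

Lemma cosl_ge4 n : (4 <= n)%N -> 1/2 <= cosl n ^+ 2.
Proof.
move=> n4; rewrite -cosl4 ler_pXn2r ?nnegrE ?cosl_ge0 //; last by case: n n4 => [|[]].
exact: cosl_mono.
Qed.

(** By monotonicity only n = 5 matters. For x = cos(pi/5), the angles 3 pi/5 and 2 pi/5 are
    supplementary, which gives 4x^2 - 2x - 1 = 0; this polynomial is negative on [1/2, 3/4). The
    bound later excludes labels above 4 inside an orbit. *)
Lemma cosl_ge5 n : (5 <= n)%N -> 3/4 <= cosl n.
Proof.
move=> n5; apply: le_trans (cosl_mono _ n5) => //.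
have g : 1/2 <= cosl 5 by apply: cosl_ge_half.
set x := cosl 5 in g *.
have c2 : cos ((pi / 5%:R) *+ 2) = 2 * x ^+ 2 - 1 :> R.
  by rewrite cos_mulr2n mulr2n /x /cosl; ring.
have e : cos ((pi / 5%:R) *+ 3) = - cos ((pi / 5%:R) *+ 2) :> R.
  have -> : (pi / 5%:R) *+ 3 = pi - (pi / 5%:R) *+ 2 :> R.
    by rewrite -(mulr_natl _ 3) -(mulr_natl _ 2); field.
  by rewrite cosB cospi sinpi; lra.
have e3 : cos ((pi / 5%:R) *+ 3) = 4 * x ^+ 3 - 3 * x :> R.
  rewrite mulrSr cosD c2 sin_mulr2n -/(cosl 5) -/x mulr2n.
  have := sin2cos2 (pi / 5%:R : R); rewrite -/(cosl 5) -/x expr2 => s2.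
  transitivity ((2 * x ^+ 2 - 1) * x -
    2 * x * (sin (pi / 5%:R) * sin (pi / 5%:R))); first by ring.
  by rewrite s2; ring.
rewrite c2 e3 in e.
have : (x + 1) * (4 * x ^+ 2 - 2 * x - 1) = 0 by lra.
move/eqP; rewrite mulf_eq0 => /orP[]/eqP; first by lra.
by rewrite leNgt => h; apply/negP => lt; nra.
Qed.

(** * Chebyshev polynomials of the second kind at cosines of labels *)

Fixpoint cheb (c : R) (n : nat) : R :=
  if n is n'.+1 then
    if n' is k.+1 then 2 * c * cheb c n' - cheb c k else 1
  else 0.

Lemma chebSS c n : cheb c n.+2 = 2 * c * cheb c n.+1 - cheb c n.
Proof. by []. Qed.

(** Identifies [cheb c n] as U_(n-1)(c), with the index shifted so that it vanishes at n = 0. The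
    induction carries two consecutive indices. *)
Lemma sin_cheb (x : R) n : sin x * cheb (cos x) n = sin (n%:R * x).
Proof.
suff: sin x * cheb (cos x) n = sin (n%:R * x) /\
      sin x * cheb (cos x) n.+1 = sin (n.+1%:R * x) by case.
elim: n => [|n [IH1 IH2]]; first by rewrite /= mul0r sin0 mulr0 mulr1 mul1r.
split => //; rewrite chebSS mulrBr IH1.
rewrite [sin x * _](_ : _ = 2 * cos x * (sin x * cheb (cos x) n.+1)); last by ring.
rewrite IH2.
have -> : n.+2%:R * x = n.+1%:R * x + x by rewrite -[in LHS]addn1 natrD; ring.
have -> : n%:R * x = n.+1%:R * x - x by rewrite -[in RHS]addn1 natrD; ring.
by rewrite sinB sinD; ring.
Qed.

Lemma cheb1 n : cheb 1 n = n%:R.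
Proof.
suff: cheb 1 n = n%:R /\ cheb 1 n.+1 = n.+1%:R by case.
elim: n => [//|n [IH1 IH2]]; split => //.
by rewrite chebSS IH1 IH2 -[n.+2]addn2 -[n.+1]addn1 !natrD; ring.
Qed.

Lemma sin_angle_gt0 n : (1 < n)%N -> 0 < sin (pi / n%:R : R).
Proof.
move=> n1; have n0 : (0 < n)%N by apply: ltnW.
apply: sin_gt0_pi; rewrite divr_gt0 ?pi_gt0 ?ltr0n //=.
by rewrite ltr_pdivrMr ?ltr0n // ltr_pMr ?pi_gt0 // ltr1n.
Qed.

Lemma mul_angle_le n j : (1 < n)%N -> (j <= n)%N -> 0 <= j%:R * ((pi : R) / n%:R) <= (pi : R).
Proof.
move=> n1 jn; have n0 : (0 < n)%N by apply: ltnW.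
rewrite mulr_ge0 ?divr_ge0 ?pi_ge0 //= mulrA ler_pdivrMr ?ltr0n //.
by rewrite mulrC ler_wpM2l ?pi_ge0 // ler_nat.
Qed.

(** For a finite label this is the sign of sin(j pi / n) up to half a turn; for the label 0 the
    value is j itself. *)
Lemma cheb_ge0 n j : n != 1 -> ((0 < n)%N -> (j <= n)%N) -> 0 <= cheb (cosl n) j.
Proof.
case: n => [|[|n]] // _ jn; first by rewrite cosl0 cheb1.
have s0 := @sin_angle_gt0 n.+2 isT.
rewrite -(pmulr_rge0 _ s0) sin_cheb; apply: sin_ge0_pi.
by apply: mul_angle_le => //; exact: jn.
Qed.

Lemma cheb_period n : (1 < n)%N ->
  cheb (cosl n) (2 * n) = 0 /\ cheb (cosl n) (2 * n).+1 = 1.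
Proof.
move=> n1; have n0 : n%:R != 0 :> R by rewrite pnatr_eq0; case: n n1.
have s0 := @sin_angle_gt0 n n1.
have e : (2 * n)%N%:R * (pi / n%:R) = pi *+ 2 :> R.
  by rewrite natrM mulr2n; field.
split; apply: (mulfI (lt0r_neq0 s0)); rewrite sin_cheb.
  by rewrite e sin2pi mulr0.
by rewrite -addn1 natrD mulrDl mul1r e addrC sinD2pi mulr1.
Qed.

(** A converse to [cheb_period]: it shows that a product of two simple reflections has no order
    smaller than its label. *)
Lemma cheb_order n j : n != 1 -> (0 < n -> j < n)%N ->
  cheb (cosl n) (2 * j) = 0 -> cheb (cosl n) (2 * j).+1 = 1 -> j = 0%N.
Proof.
case: n => [|[|n]] // _ jn.
  by rewrite cosl0 !cheb1 => /eqP; rewrite pnatr_eq0 muln_eq0 => /eqP.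
move=> u0 u1; case: j jn u0 u1 => [//|j] /(_ isT) jn u0 u1; exfalso.
set x := pi / n.+2%:R : R; have s0 : 0 < sin x by exact: sin_angle_gt0.
have := sin_cheb x (2 * j.+1); rewrite /x -/(cosl _) u0 mulr0 -/x => e0.
have := sin_cheb x (2 * j.+1).+1; rewrite /x -/(cosl _) u1 mulr1 -/x => e1.
move: e1; rewrite -addn1 natrD mulrDl mul1r sinD -e0 mul0r add0r => e1.
have c1 : cos ((2 * j.+1)%:R * x) = 1.
  by apply: (mulIf (lt0r_neq0 s0)); rewrite mul1r -e1.
(* The angle lies strictly between 0 and pi, so the cosine of its double is 1 - 2 sin^2 < 1, against
   [c1]. *)
have sj : 0 < sin (j.+1%:R * x).
  apply: sin_gt0_pi; rewrite /x mulr_gt0 ?ltr0n // ?divr_gt0 ?pi_gt0 ?ltr0n //=.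
  rewrite mulrA ltr_pdivrMr ?ltr0n // mulrC.
  by rewrite ltr_pM2l ?pi_gt0 // ltr_nat.
move: c1; rewrite natrM -mulrA mulr_natl cos_mulr2n cos2sin2 mulr2n => c1.
by have := exprn_gt0 2 sj; lra.
Qed.

End CosineOfCoxeterLabels.

Arguments cheb : simpl never.

(** * Words in a presented group *)

(** Self-bijections of an arbitrary type, with the inverse as data, form a group. It is the target
    to which the universal property is applied for translations, for parity and for the geometric
    action. *)
Record bijections (X : Type) := Bijection {
  bij_fun : X -> X;
  bij_inv : X -> X;
  bij_funK : cancel bij_fun bij_inv;
  bij_invK : cancel bij_inv bij_fun }.

Section BijectionGroup.
Variable X : Type.

Lemma bijections_eq (f g : bijections X) : bij_fun f =1 bij_fun g -> f = g.
Proof.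
case: f g => [f f' fK f'K] [g g' gK g'K] /= /funext e.
have e' : f' = g' by apply/funext => x; apply: (can_inj gK); rewrite -{1}e f'K g'K.
rewrite {}e {}e' in fK f'K *.
by rewrite (Prop_irrelevance fK gK) (Prop_irrelevance f'K g'K).
Qed.

HB.instance Definition _ := gen_eqMixin (bijections X).
HB.instance Definition _ := gen_choiceMixin (bijections X).

Definition bij_one : bijections X := Bijection (frefl id) (frefl id).

Definition bij_opp (f : bijections X) : bijections X :=
  Bijection (@bij_invK _ f) (@bij_funK _ f).

Definition bij_mul (f g : bijections X) : bijections X :=
  Bijection (can_comp (@bij_funK _ f) (@bij_funK _ g))
            (can_comp (@bij_invK _ g) (@bij_invK _ f)).

Lemma bij_mulA : associative bij_mul.
Proof. by move=> f g h; apply: bijections_eq. Qed.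

Lemma bij_mul1 : left_id bij_one bij_mul.
Proof. by move=> f; apply: bijections_eq. Qed.

Lemma bij_mulr1 : right_id bij_one bij_mul.
Proof. by move=> f; apply: bijections_eq. Qed.

Lemma bij_mulV : left_inverse bij_one bij_opp bij_mul.
Proof. by move=> f; apply: bijections_eq => x /=; exact: bij_funK. Qed.

Lemma bij_mulrV : right_inverse bij_one bij_opp bij_mul.
Proof. by move=> f; apply: bijections_eq => x /=; exact: bij_invK. Qed.

HB.instance Definition _ := isGroup.Build (bijections X)
  bij_mulA bij_mul1 bij_mulr1 bij_mulV bij_mulrV.

Lemma bij_mulE (f g : bijections X) x : bij_fun (f * g) x = bij_fun f (bij_fun g x).
Proof. by []. Qed.

End BijectionGroup.

Lemma morph1 (G H : groupType) (f : {multiplicative G -> H}) : f 1 = 1.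
Proof. by apply: (mulgI (f 1)); rewrite -gmulfM !mulg1. Qed.

Lemma morphX (G H : groupType) (f : {multiplicative G -> H}) x n :
  f (x ^+ n) = f x ^+ n.
Proof. by elim: n => [|n IH]; rewrite ?morph1 // !expgS gmulfM IH. Qed.

Section Alternating.
Variable G : groupType.
Implicit Types a b : G.

Fixpoint alt a b n : G := if n is n'.+1 then a * alt b a n' else 1.

(** Inverting an alternating product of involutions reverses it, so the quotient is again
    alternating, with 2n factors. *)
Lemma alt_div a b n : b * b = 1 -> a * a = 1 -> alt a b n / alt b a n = (a * b) ^+ n.
Proof.
elim: n a b => [|n IH] a b bb aa; first by rewrite /= divg1.
have vb : b^-1 = b by apply: (mulgI b); rewrite mulgV.
rewrite /= invgM vb mulgA -(mulgA a) IH //.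
suff -> : a * (b * a) ^+ n = (a * b) ^+ n * a by rewrite -mulgA -expgSr.
elim: n {IH} => [|n IH]; first by rewrite mulg1 mul1g.
by rewrite [in LHS]expgS expgS -!mulgA -IH !mulgA.
Qed.

Lemma alt_braid a b n :
  a * a = 1 -> b * b = 1 -> (a * b) ^+ n = 1 -> alt a b n = alt b a n.
Proof. by move=> aa bb; rewrite -alt_div // => /divg1_eq. Qed.

End Alternating.

Definition word_prod (T : Type) (G : groupType) (r : T -> G) (c : seq T) : G :=
  \prod_(s <- c) r s.

Section Words.
Variables (T : Type) (G : groupType) (r : T -> G).
Local Notation ev := (word_prod r).

Lemma word_nil : ev [::] = 1.
Proof. exact: big_nil. Qed.

Lemma word_cons s c : ev (s :: c) = r s * ev c.
Proof. exact: big_cons. Qed.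

Lemma word_cat c d : ev (c ++ d) = ev c * ev d.
Proof. exact: big_cat. Qed.

Lemma word_rev c : (forall s, r s * r s = 1) -> ev (rev c) = (ev c)^-1.
Proof.
move=> rr; elim: c => [|s c IH]; first by rewrite word_nil invg1.
rewrite rev_cons -cats1 word_cat IH !word_cons word_nil mulg1 invgM.
by congr (_ * _); apply: (mulgI (r s)); rewrite rr mulgV.
Qed.

End Words.

Section Presentation.
Variables (T : finType) (m : T -> T -> nat) (W : groupType) (r : T -> W).
Hypothesis pres : coxeter_group m r.

Lemma pres_ext (G : groupType) (phi psi : {multiplicative W -> G}) :
  (forall s, phi (r s) = psi (r s)) -> phi =1 psi.
Proof.
move=> e; case: pres => rel univ.
have [|h [_ hu]] := univ G (fun s => psi (r s)).
  by move=> s t; rewrite -gmulfM -morphX rel morph1.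
by move=> x; rewrite (hu phi e) (hu psi).
Qed.

(* Left translations of W * bool are compared with their conjugates by the
   involution swapping (x, true) and (x, false) when x is a word; the two
   homomorphisms agree on the generators, hence everywhere. *)
Lemma pres_words : (forall s, r s * r s = 1) -> forall w, exists c, word_prod r c = w.
Proof.
move=> rr w; pose H x := exists c, word_prod r c = x.
have Hr s x : H (r s * x) <-> H x.
  split=> [] [c ec]; exists (s :: c); rewrite word_cons ec //.
  by rewrite mulgA rr mul1g.
have LK (x : W) : cancel (fun y : W * bool => (x * y.1, y.2))
                   (fun y : W * bool => (x^-1 * y.1, y.2)).
  by move=> [y b] /=; rewrite mulKg.
have LVK (x : W) : cancel (fun y : W * bool => (x^-1 * y.1, y.2))
                   (fun y : W * bool => (x * y.1, y.2)).
  by move=> [y b] /=; rewrite mulVKg.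
pose L x := Bijection (LK x) (LVK x).
have LM : {morph L : x y / x * y}.
  by move=> x y; apply: bijections_eq => z; rewrite bij_mulE /= mulgA.
pose sw (y : W * bool) := if `[< H y.1 >] then (y.1, ~~ y.2) else y.
have swK : involutive sw.
  move=> [y b]; rewrite /sw /=; have [h|h] := pselect (H y).
    by rewrite ?(asboolT h) /= ?(asboolT h) negbK.
  by rewrite ?(asboolF h) /= ?(asboolF h).
pose J := Bijection swK swK.
have JJ : J * J = 1 by apply: bijections_eq => y; exact: swK.
pose L' x := J * L x * J.
have L'M : {morph L' : x y / x * y}.
  by move=> x y; rewrite /L' LM !mulgA -(mulgA _ J J) JJ mulg1.
pose phi : {multiplicative W -> bijections (W * bool)} :=
  HB.pack L (isMultiplicative.Build _ _ L LM).
pose psi : {multiplicative W -> bijections (W * bool)} :=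
  HB.pack L' (isMultiplicative.Build _ _ L' L'M).
have e s : phi (r s) = psi (r s).
  apply: bijections_eq => -[y b]; rewrite /= /sw /=; have [h|h] := pselect (H y).
    by rewrite (asboolT h) /= (asboolT ((Hr s y).2 h)) negbK.
  by rewrite (asboolF h) /= (asboolF (fun h' => h ((Hr s y).1 h'))).
have /(congr1 (fun f => (bij_fun f (1, true)).2)) := pres_ext e w.
have H1 : H 1 by exists [::]; rewrite word_nil.
rewrite /= /sw /= (asboolT H1) /= mulg1.
by case: ifPn => [/asboolP|].
Qed.

(** All relators have even length, so sending every generator to the swap of [bool] extends to the
    sign homomorphism. *)
Lemma pres_parity c d : word_prod r c = word_prod r d -> odd (size c) = odd (size d).
Proof.
pose n : bijections bool := Bijection negbK negbK.
case: pres => _ /(_ _ (fun=> n)) [|phi [hphi _]].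
  have nn : n * n = 1 by apply: bijections_eq => b; exact: negbK.
  by move=> s t; rewrite nn expg1n.
have hw e : bij_fun (phi (word_prod r e)) false = odd (size e).
  elim: e => [|s e IH]; first by rewrite word_nil morph1.
  by rewrite word_cons gmulfM bij_mulE IH hphi.
by move=> e; rewrite -!hw e.
Qed.

End Presentation.

(** * The geometric representation *)

Section GeometricRepresentation.
Import Order.TTheory GRing.Theory Num.Theory.
Local Open Scope ring_scope.
Variables (R : realType) (T : finType).
Implicit Types (v a b : T -> R) (p q : R).

Definition lincomb p a q b : T -> R := fun t => p * a t + q * b t.
Local Notation lc := lincomb.

Lemma lincombC p a q b : lc p a q b = lc q b p a.
Proof. by apply/funext => t; rewrite /lc addrC. Qed.

Lemma lincomb10 a b : lc 1 a 0 b = a.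
Proof. by apply/funext => t; rewrite /lc mul1r mul0r addr0. Qed.

Lemma lincomb01 a b : lc 0 a 1 b = b.
Proof. by rewrite lincombC lincomb10. Qed.

Definition vroot (s : T) : T -> R := fun t => (t == s)%:R.

(** The map [f] is applied first, so the order is opposite to that of a product [alt]; it matches
    the action of the inverse of [alt]. *)
Fixpoint alt_fun (f g : (T -> R) -> T -> R) n v :=
  if n is n'.+1 then alt_fun g f n' (f v) else v.

Lemma iter_comp_alt f g n v : iter n (f \o g) v = alt_fun g f (2 * n) v.
Proof.
elim: n v => [//|n IH] v.
by rewrite iterSr IH mulnS.
Qed.

Section Dihedral.
Variables (c : R).
Local Notation U := (cheb c).

(** Reflections in two unit vectors a, b with B(a, b) = -c, on the combinations of a and b. The
    abstract form serves both for simple reflections and for the longest elements of two orbits. *)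
Definition dihedral_pair f g a b :=
  (forall p q, f (lc p a q b) = lc (2 * c * q - p) a q b) /\
  (forall p q, g (lc p a q b) = lc p a (2 * c * p - q) b).

Lemma dihedral_pairC f g a b : dihedral_pair f g a b -> dihedral_pair g f b a.
Proof. by move=> [hf hg]; split=> p q; rewrite lincombC ?hf ?hg lincombC. Qed.

(** Each reflection replaces the older of two consecutive Chebyshev values by the next one, which is
    exactly the three-term recurrence. *)
Lemma alt_fun_cheb f g a b z i j : dihedral_pair f g a b ->
  alt_fun g f j (lc (z * U i.+1) a (z * U i) b) =
  if odd j then lc (z * U (i + j)) a (z * U (i + j).+1) b
  else lc (z * U (i + j).+1) a (z * U (i + j)) b.
Proof.
elim: j f g a b i => [|j IH] f g a b i h; first by rewrite addn0.
have [_ hg] := h; rewrite /= hg.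
have -> : 2 * c * (z * U i.+1) - z * U i = z * U i.+2 by rewrite chebSS; ring.
rewrite lincombC (IH _ _ _ _ i.+1 (dihedral_pairC h)) addSnnS.
by case: (odd j); rewrite /= lincombC.
Qed.

Lemma dihedral_period f g a b n : dihedral_pair f g a b ->
  U (2 * n) = 0 -> U (2 * n).+1 = 1 ->
  iter n (f \o g) a = a /\ iter n (f \o g) b = b.
Proof.
move=> h u0 u1; rewrite !iter_comp_alt; split.
  have := alt_fun_cheb 1 0 (2 * n) h.
  by rewrite /= oddM /= add0n u0 u1 mulr1 mulr0 lincomb10.
(* Since [g] sends b to -b, the first reflection is split off; the odd number that remains is
   covered by [alt_fun_cheb] with a and b exchanged and [z] = -1. *)
case: n u0 u1 => [//|n]; rewrite mulnS !addSn add0n => u0 u1.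
have [_ hg] := h; rewrite -[LHS]/(alt_fun f g (2 * n).+1 (g b)) -{1}(lincomb01 a b) hg.
have -> : lc 0 a (2 * c * 0 - 1) b = lc (-1 * U 1) b (-1 * U 0) a.
  by rewrite lincombC /cheb; congr lc; ring.
rewrite (alt_fun_cheb _ _ _ (dihedral_pairC h)) /= oddM /= add0n u0.
have -> : U (2 * n).+1 = -1 by move: u1; rewrite chebSS u0; lra.
by rewrite mulr0 mulrNN mulr1 lincombC lincomb01.
Qed.

End Dihedral.

Variable m : T -> T -> nat.
Hypothesis hm : coxeter_matrix m.

Let mss s : m s s = 1%N. Proof. by case: hm. Qed.
Let msym s t : m s t = m t s. Proof. by case: hm. Qed.
Let mst s t : s != t -> m s t != 1%N. Proof. by case: hm => _ _; exact. Qed.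

(* B(v, alpha_s), where B(alpha_u, alpha_s) = - cos (pi / m u s). *)
Definition coroot s v : R := \sum_u v u * - cosl R (m u s).

Definition refl s v : T -> R := lc 1 v (- (2 * coroot s v)) (vroot s).

Lemma coroot_lincomb s p a q b :
  coroot s (lc p a q b) = p * coroot s a + q * coroot s b.
Proof.
rewrite /coroot !mulr_sumr -big_split; apply: eq_bigr => u _ /=.
by rewrite /lc; ring.
Qed.

Lemma coroot_root s t : coroot s (vroot t) = - cosl R (m t s).
Proof.
rewrite /coroot (bigD1 t) //= /vroot eqxx mul1r big1 ?addr0 // => u /negbTE ->.
by rewrite mul0r.
Qed.

Lemma refl_lincomb s p a q b : refl s (lc p a q b) = lc p (refl s a) q (refl s b).
Proof. by apply/funext => t; rewrite /refl coroot_lincomb /lc; ring. Qed.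

Lemma refl_root s : refl s (vroot s) = fun t => - vroot s t.
Proof.
by apply/funext => t; rewrite /refl coroot_root mss cosl1 /lc; ring.
Qed.

Lemma reflK s : involutive (refl s).
Proof.
move=> v; rewrite {2}/refl refl_lincomb refl_root; apply/funext => t.
by rewrite /refl /lc; ring.
Qed.

Lemma refl_fix s v : coroot s v = 0 -> refl s v = v.
Proof. by rewrite /refl => ->; apply/funext => t; rewrite /lc; ring. Qed.

Lemma refl_pair s t :
  dihedral_pair (cosl R (m s t)) (refl s) (refl t) (vroot s) (vroot t).
Proof.
split=> p q; rewrite refl_lincomb refl_root; apply/funext => u;
  rewrite /refl coroot_root /lc ?(msym t s); ring.
Qed.

(** For a finite label the form is nondegenerate on the plane of the two roots. A vector is then the
    sum of a part in the plane, where the product is a rotation, and a part orthogonal to it, which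
    both reflections fix. *)
Lemma refl_relation s t v : iter (m s t) (refl s \o refl t) v = v.
Proof.
have [<-|st] := eqVneq s t; first by rewrite mss /= reflK.
have [->//|m0] := eqVneq (m s t) 0%N.
have m1 : (1 < m s t)%N by have := mst st; move: m0; case: (m s t) => [|[]].
set c := cosl R (m s t); set n := m s t in m1 *.
have c2 : 1 - c ^+ 2 != 0.
  by rewrite /c /cosl -sin2cos2 expf_neq0 // lt0r_neq0 // sin_angle_gt0.
pose x := coroot s v; pose y := coroot t v.
(* Coefficients of the orthogonal projection of v to the plane; 1 - c^2 is the Gram determinant. *)
pose p := (x + c * y) / (1 - c ^+ 2); pose q := (y + c * x) / (1 - c ^+ 2).
pose e := lc p (vroot s) q (vroot t); pose v0 := lc 1 v (-1) e.
have s0 : coroot s v0 = 0.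
  rewrite !coroot_lincomb !coroot_root mss cosl1 (msym t s) -/c -/x /p /q; field.
  exact: c2.
have t0 : coroot t v0 = 0.
  rewrite !coroot_lincomb !coroot_root mss cosl1 -/n -/c -/y /p /q; field.
  exact: c2.
have -> : v = lc 1 v0 1 e by apply/funext => u; rewrite /v0 /lc; ring.
have lin k p' a q' b : iter k (refl s \o refl t) (lc p' a q' b) =
    lc p' (iter k (refl s \o refl t) a) q' (iter k (refl s \o refl t) b).
  by elim: k => [//|k IH]; rewrite !iterS IH /= !refl_lincomb.
have [u0 u1] := cheb_period R m1.
have [fs ft] := dihedral_period (refl_pair s t) u0 u1.
rewrite lin; congr lc; first by elim: n {m1 u0 u1 fs ft} => [//|k IH]; rewrite iterS IH /= !refl_fix.
by rewrite /e lin fs ft.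
Qed.

Definition geometric_action (W : groupType) (r : T -> W)
    (act : W -> (T -> R) -> T -> R) :=
  [/\ forall v, act 1%g v = v,
      forall x y v, act (x * y)%g v = act x (act y v) &
      forall s v, act (r s) v = refl s v].

Lemma geometric_action_exists (W : groupType) (r : T -> W) :
  coxeter_group m r -> exists act, geometric_action r act.
Proof.
case=> _ /(_ _ (fun s => Bijection (reflK s) (reflK s))) [|phi [hphi _]].
  move=> s t; apply: bijections_eq => v /=.
  rewrite -[RHS](refl_relation s t); elim: (m s t) v => [//|n IH] v.
  by rewrite expgSr bij_mulE IH iterSr.
exists (fun w => bij_fun (phi w)); split=> [v|x y v|s v].
- by rewrite morph1.
- by rewrite gmulfM.
- by rewrite hphi.
Qed.

End GeometricRepresentation.

(** * Descents and longest elements *)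

Lemma alt_add (G : groupType) (a b : G) n k :
  alt a b (n + k) = (alt a b n * (if odd n then alt b a k else alt a b k))%g.
Proof.
elim: n a b => [|n IH] a b; first by rewrite mul1g.
by rewrite addSn /= IH mulgA; case: (odd n).
Qed.

Fixpoint alt_word (T : Type) (s t : T) n : seq T :=
  if n is n'.+1 then s :: alt_word t s n' else [::].

Lemma size_alt_word (T : Type) (s t : T) n : size (alt_word s t n) = n.
Proof. by elim: n s t => [//|n IH] s t /=; rewrite IH. Qed.

Lemma word_alt (T : Type) (G : groupType) (r : T -> G) s t n :
  word_prod r (alt_word s t n) = alt (r s) (r t) n.
Proof.
by elim: n s t => [|n IH] s t; rewrite ?word_nil //= word_cons IH.
Qed.

Section CoxeterTheory.
Import Order.TTheory GRing.Theory Num.Theory.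
Local Open Scope ring_scope.
Variables (R : realType) (T : finType) (m : T -> T -> nat).
Variables (W : groupType) (r : T -> W) (act : W -> (T -> R) -> T -> R).
Hypothesis hm : coxeter_matrix m.
Hypothesis pres : coxeter_group m r.
Hypothesis hact : geometric_action m r act.

Local Notation ev := (word_prod r).
Local Notation len := (cox_length r).
Local Notation root := (@vroot R T).
Local Notation lc := (@lincomb R T).
Local Notation coroot := (@coroot R T m).
Local Notation refl := (@refl R T m).

Implicit Types (s t : T) (x y w : W) (c : seq T) (v : T -> R) (K : {set T}).

Lemma gen_sq s : (r s * r s = 1)%g.
Proof. by case: pres => /(_ s s); case: hm => -> _ _. Qed.

Lemma gen_inv s : ((r s)^-1 = r s)%g.
Proof. by apply: (mulgI (r s)); rewrite gen_sq mulgV. Qed.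

Lemma genK s : cancel (fun w => r s * w)%g (fun w => r s * w)%g.
Proof. by move=> w; rewrite mulgA gen_sq mul1g. Qed.

Lemma words w : exists c, ev c = w.
Proof. exact: (pres_words pres gen_sq). Qed.

Lemma act1 v : act 1%g v = v. Proof. by case: hact. Qed.
Lemma actM x y v : act (x * y)%g v = act x (act y v). Proof. by case: hact. Qed.
Lemma act_gen s v : act (r s) v = refl s v. Proof. by case: hact. Qed.

Lemma actK w v : act w^-1%g (act w v) = v.
Proof. by rewrite -actM mulVg act1. Qed.

Lemma act_lincomb w p a q b : act w (lc p a q b) = lc p (act w a) q (act w b).
Proof.
have [c <-] := words w; elim: c => [|s c IH]; first by rewrite word_nil !act1.
by rewrite word_cons !actM IH !act_gen refl_lincomb.
Qed.

Lemma act_scale w p v : act w (fun t => p * v t) = fun t => p * act w v t.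
Proof.
have e u : (fun t => p * u t) = lc p u 0 u.
  by apply/funext => t; rewrite /lincomb mul0r addr0.
by rewrite e act_lincomb -e.
Qed.

Lemma act_opp w v : act w (fun t => - v t) = fun t => - act w v t.
Proof.
have e u : (fun t => - u t) = fun t => -1 * u t by apply/funext => t; rewrite mulN1r.
by rewrite !e act_scale.
Qed.

Lemma act_expand w v t : act w v t = \sum_s v s * act w (root s) t.
Proof.
have -> : v = fun t => \sum_(s <- enum T) v s * root s t.
  apply/funext => u; rewrite big_enum (bigD1 u) //= /vroot eqxx mulr1 big1 ?addr0 //.
  by move=> s /negbTE; rewrite eq_sym => ->; rewrite mulr0.
rewrite -big_enum /=; set f := fun u => _.
transitivity (\sum_(s <- enum T) v s * act w (root s) t); last first.
  apply: eq_bigr => s _; congr (_ * _); rewrite /f big_enum (bigD1 s) //= /vroot eqxx mulr1.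
  rewrite big1 ?addr0 // => u /negbTE; rewrite eq_sym => ->; exact: mulr0.
rewrite {}/f; elim: (enum T) => [|s l IH].
  rewrite big_nil (_ : (fun _ => _) = fun u => 0 * 0); last first.
    by apply/funext => u; rewrite big_nil mul0r.
  by rewrite (act_scale w 0 (fun=> 0)) mul0r.
rewrite big_cons -IH (_ : (fun _ => _) =
  lc (v s) (root s) 1 (fun u => \sum_(s <- l) v s * root s u)).
  by rewrite act_lincomb /lincomb mul1r.
by apply/funext => u; rewrite big_cons /lincomb mul1r.
Qed.

Lemma len_is_length w : is_length r w (len w).
Proof.
rewrite /cox_length; set A := [set n | _]%classic.
apply: (xgetPex 0%N (P := A)); rewrite /A /=.
have ex : exists n, `[< exists2 c, size c = n & ev c = w >].
  by have [c e] := words w; exists (size c); apply/asboolP; exists c.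
exists (ex_minn ex); case: ex_minnP => n /asboolP hn hmin; split=> // c e.
by apply: hmin; apply/asboolP; exists c.
Qed.

Lemma reduced_word w : exists2 c, size c = len w & ev c = w.
Proof. by case: (len_is_length w). Qed.

Lemma len_le c : (len (ev c) <= size c)%N.
Proof. by case: (len_is_length (ev c)) => _; apply. Qed.

Lemma len_parity c : odd (len (ev c)) = odd (size c).
Proof. by have [d <- e] := reduced_word (ev c); exact: (pres_parity pres e). Qed.

Lemma len1 : len 1%g = 0%N.
Proof. by apply/eqP; rewrite -leqn0 -(word_nil r); exact: (len_le [::]). Qed.

Lemma len_eq0 w : len w = 0%N -> w = 1%g.
Proof. by have [c <- <-] := reduced_word w; case: c => // _; exact: word_nil. Qed.

Lemma len_invg w : len w^-1%g = len w.
Proof.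
suff h u : (len u^-1%g <= len u)%N.
  by apply/eqP; rewrite eqn_leq h -{1}(invgK w) h.
have [c <- <-] := reduced_word u.
by rewrite -(word_rev _ gen_sq) -(size_rev c) len_le.
Qed.

Lemma len_mul x y : (len (x * y)%g <= len x + len y)%N.
Proof.
have [c <- ex] := reduced_word x; have [d <- ey] := reduced_word y.
by rewrite -{1}ex -{1}ey -word_cat -size_cat len_le.
Qed.

Lemma len_gen_le s w : (len (r s * w)%g <= (len w).+1)%N.
Proof.
by have [c <- {1}<-] := reduced_word w; rewrite -word_cons -[(size c).+1]/(size (s :: c)) len_le.
Qed.

Lemma len_gen_parity s w : odd (len (r s * w)%g) = ~~ odd (len w).
Proof. by have [c <-] := words w; rewrite -word_cons !len_parity. Qed.

Definition desc s w : bool := (len (r s * w)%g < len w)%N.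

Lemma len_desc s w : desc s w -> len w = (len (r s * w)%g).+1.
Proof.
rewrite /desc => h; have := len_gen_le s (r s * w)%g; rewrite genK; lia.
Qed.

(** Multiplication by a generator flips the parity of the length, so equality of lengths is
    impossible. *)
Lemma len_ndesc s w : ~~ desc s w -> len (r s * w)%g = (len w).+1.
Proof.
rewrite /desc -leqNgt => h; have := len_gen_le s w; have := len_gen_parity s w.
move=> e; have ne : len (r s * w)%g != len w.
  by apply/eqP => h2; move: e; rewrite h2; case: (odd _).
lia.
Qed.

Lemma desc_gen s w : desc s (r s * w)%g = ~~ desc s w.
Proof.
case: (boolP (desc s w)) => h; last by rewrite /desc genK (len_ndesc h) ltnS leqnn.
by rewrite /desc genK (len_desc h) ltnNge leqnSn.
Qed.

Lemma desc_ex w : w != 1%g -> exists s, desc s w.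
Proof.
have [[|s c] sz e] := reduced_word w; first by rewrite -e word_nil eqxx.
by move=> _; exists s; rewrite /desc -sz -e word_cons genK ltnS len_le.
Qed.

(** Removing t, s, t, ... from the left as long as the length drops writes w as a dihedral factor
    times the minimal element of its coset, with additive lengths. *)
Lemma strip s t w n : (len w <= n)%N -> desc t w ->
  exists j (v : W), [/\ w = (alt (r t) (r s) j.+1 * v)%g, len w = (len v + j.+1)%N,
                  ~~ desc s v & ~~ desc t v].
Proof.
elim: n s t w => [|n IH] s t w hn ht.
  by move: ht; rewrite /desc; move: hn; case: (len w).
have lw := len_desc ht; set w' := (r t * w)%g in lw.
have ew : w = (r t * w')%g by rewrite genK.
have nt : ~~ desc t w' by rewrite /w' desc_gen ht.
case: (boolP (desc s w')) => hs; last first.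
  by exists 0%N, w'; rewrite /= mulg1 addn1.
have [|j [v [e1 e2 h1 h2]]] := IH t s w' _ hs; first by rewrite -ltnS -lw.
exists j.+1, v; split=> //; first by rewrite ew {1}e1 mulgA.
by rewrite lw e2 -addnS.
Qed.

(** * Positive and negative roots, and their relation to length *)

Definition nonneg v := forall t, 0 <= v t.
Definition nonpos v := forall t, v t <= 0.

Lemma act_alt_inv s t n v :
  act (alt (r s) (r t) n)^-1%g v = alt_fun (refl s) (refl t) n v.
Proof.
elim: n s t v => [|n IH] s t v /=; first by rewrite invg1 act1.
by rewrite invgM actM gen_inv act_gen IH.
Qed.

(** Induction on length: with w = x v from [strip], the inverse of x sends the root s to a
    nonnegative combination of the roots s and t, and the induction hypothesis for v applies to
    both. *)
Lemma ndesc_nonneg s w : ~~ desc s w -> nonneg (act w^-1%g (root s)).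
Proof.
move: {2}(len w).+1 (ltnSn (len w)) => n; elim: n w s => [//|n IH] w s.
rewrite ltnS => hn hs; have [e1|w1] := eqVneq w 1%g.
  by rewrite e1 invg1 act1 => t; rewrite /vroot ler0n.
have [t ht] := desc_ex w1; have [j [v [ew el hsv htv]]] := strip s (leqnn _) ht.
have st : s != t by apply: contraNneq hs => ->.
have lv : (len v < n)%N by rewrite (leq_trans _ hn) // el; lia.
have ps := IH _ _ lv hsv; have pt := IH _ _ lv htv.
(* With m s t or more alternating factors, the braid relation would let w start with s, making s a
   descent. The strict bound keeps the Chebyshev index j + 2 within the range of [cheb_ge0]. *)
have jm : (0 < m s t)%N -> (j.+1 < m s t)%N.
  move=> m0; rewrite ltnNge; apply/negP => mj.
  have br : alt (r s) (r t) (m s t) = alt (r t) (r s) (m s t).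
    by apply: alt_braid; rewrite ?gen_sq //; case: pres.
  move: hs ew; rewrite -(subnKC mj) alt_add -br.
  case: (m s t) m0 mj {br} => [//|k] _ kj /=.
  set y := (if _ then _ else _)%g; rewrite -!mulgA => hs ew.
  move: hs; rewrite /desc el {1}ew genK; apply/negP; rewrite negbK.
  have ly : (len y <= j.+1 - k.+1)%N.
    by rewrite /y; case: ifP => _; rewrite -word_alt (leq_trans (len_le _)) ?size_alt_word.
  have lk : (len (alt (r t) (r s) k) <= k)%N.
    by rewrite -word_alt (leq_trans (len_le _)) ?size_alt_word.
  apply: leq_ltn_trans (len_mul _ _) _; apply: leq_ltn_trans (leq_add lk _) _.
    exact: leq_trans (len_mul _ _) (leq_add ly (leqnn _)).
  by lia.
rewrite ew invgM actM act_alt_inv.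
have -> : root s = lc (1 * cheb (cosl R (m s t)) 1) (root s)
    (1 * cheb (cosl R (m s t)) 0) (root t).
  by rewrite /cheb mulr0 mulr1 lincomb10.
rewrite (alt_fun_cheb _ _ _ (refl_pair R hm s t)) !mul1r add0n.
have mst : m s t != 1%N by case: hm => _ _; apply.
have u1 : 0 <= cheb (cosl R (m s t)) j.+1 by apply: cheb_ge0 => // /jm /ltnW.
have u2 : 0 <= cheb (cosl R (m s t)) j.+2 by apply: cheb_ge0.
by case: ifP => _; rewrite act_lincomb => u; rewrite addr_ge0 ?mulr_ge0.
Qed.

Lemma desc_nonpos s w : desc s w -> nonpos (act w^-1%g (root s)).
Proof.
rewrite -[desc s w]negbK -desc_gen => /ndesc_nonneg h t.
have := h t; rewrite invgM gen_inv actM act_gen refl_root // act_opp; lra.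
Qed.

Lemma nonneg_nonpos0 v : nonneg v -> nonpos v -> v = fun=> 0.
Proof. by move=> p n; apply/funext => t; apply/eqP; rewrite eq_le p n. Qed.

Lemma act_eq0 w v : act w v = (fun=> 0) -> v = fun=> 0.
Proof.
have z u : act u (fun=> 0) = fun=> 0.
  rewrite (_ : (fun=> 0) = fun t : T => 0 * (0 : R)); last by apply/funext => t; rewrite mul0r.
  by rewrite (act_scale u 0 (fun=> 0)); apply/funext => t; rewrite !mul0r.
by move=> e; rewrite -(actK w v) e z.
Qed.

Lemma root_neq0 s : root s <> fun=> 0.
Proof. by move/(congr1 (@^~ s)); rewrite /vroot eqxx => /eqP; rewrite oner_eq0. Qed.

Lemma nonneg_ndesc s w : nonneg (act w^-1%g (root s)) -> ~~ desc s w.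
Proof.
move=> p; apply/negP => /desc_nonpos n.
exact: root_neq0 (act_eq0 (nonneg_nonpos0 p n)).
Qed.

Lemma nonpos_desc s w : nonpos (act w^-1%g (root s)) -> desc s w.
Proof.
move=> n; apply/negPn/negP => /ndesc_nonneg p.
exact: root_neq0 (act_eq0 (nonneg_nonpos0 p n)).
Qed.

Lemma gen_inj : injective r.
Proof.
move=> s t e; apply/eqP/negPn/negP => st.
have := congr1 (fun w => act w (root s) s) e.
rewrite !act_gen refl_root // /refl /lincomb /vroot eqxx (negbTE st) /= {e}; lra.
Qed.

(** The remainder of j modulo the label fixes the root s, hence is 0 by [cheb_order]. For the label
    0 the remainder is j itself, so the order is infinite. *)
Lemma gen_order s t j : ((r s * r t) ^+ j = 1)%g -> (m s t %| j)%N.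
Proof.
have [<-|st] := eqVneq s t; first by case: hm => -> _ _ _; exact: dvd1n.
have mst : m s t != 1%N by case: hm => _ _; apply.
have rel : ((r s * r t) ^+ m s t = 1)%g by case: pres.
move=> e; apply/eqP; pose k := (j %% m s t)%N; rewrite -/k.
have ek : act ((r s * r t) ^+ k)%g (root s) = root s.
  suff -> : ((r s * r t) ^+ k = 1)%g by rewrite act1.
  by move: e; rewrite {1}(divn_eq j (m s t)) expgnDr mulnC expgnA rel expg1n mul1g.
have it n v : act ((r s * r t) ^+ n)%g v = iter n (refl s \o refl t) v.
  by elim: n v => [|n IH] v; rewrite ?act1 // expgSr iterSr actM IH actM !act_gen.
move: ek; rewrite it iter_comp_alt.
have {1}-> : root s = lc (1 * cheb (cosl R (m s t)) 1) (root s)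
    (1 * cheb (cosl R (m s t)) 0) (root t).
  by rewrite /cheb mulr0 mulr1 lincomb10.
rewrite (alt_fun_cheb _ _ _ (refl_pair R hm s t)) !mul1r add0n oddM /= => ek.
apply: (@cheb_order R (m s t)) => //.
- by move=> m0; rewrite ltn_mod.
- have := congr1 (@^~ t) ek; rewrite /lincomb /vroot eqxx eq_sym (negbTE st) /=; lra.
- have := congr1 (@^~ s) ek; rewrite /lincomb /vroot eqxx (negbTE st) /=; lra.
Qed.

(** * Parabolic subgroups and their cosets *)

Definition in_parab K w := exists2 c, all (mem K) c & ev c = w.

Lemma in_parab1 K : in_parab K 1%g.
Proof. by exists [::]; rewrite ?word_nil. Qed.

Lemma in_parab_gen K s : s \in K -> in_parab K (r s).
Proof. by exists [:: s]; rewrite /= ?andbT // word_cons word_nil mulg1. Qed.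

Lemma in_parabM K x y : in_parab K x -> in_parab K y -> in_parab K (x * y)%g.
Proof.
by move=> [c hc <-] [d hd <-]; exists (c ++ d); rewrite ?all_cat ?hc // word_cat.
Qed.

Lemma in_parabV K x : in_parab K x -> in_parab K x^-1%g.
Proof.
by move=> [c hc <-]; exists (rev c); rewrite ?all_rev // (word_rev _ gen_sq).
Qed.

Lemma in_parabS K (L : {set T}) x : K \subset L -> in_parab K x -> in_parab L x.
Proof.
move=> /fintype.subsetP KL [c hc <-]; exists c => //.
by apply/allP => s /(allP hc) /KL.
Qed.

Lemma in_parab_ind K (P : W -> Prop) : P 1%g ->
  (forall s x, s \in K -> in_parab K x -> P x -> P (r s * x)%g) ->
  forall x, in_parab K x -> P x.
Proof.
move=> P1 PS x [c hc <-]; elim: c hc => [|s c IH] /=; first by rewrite word_nil.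
by case/andP=> sK hc; rewrite word_cons; apply: PS (IH hc) => //; exists c.
Qed.

Lemma parabolicE K w : parabolic r K w <-> in_parab K w.
Proof.
split.
  apply: (smallest_sub (X := in_parab K)).
    by split=> [|x y hx hy]; [exact: in_parab1 | apply: in_parabM => //; exact: in_parabV].
  by move=> _ [s sK <-]; exact: in_parab_gen.
move=> h H [[H1 HM] HK].
have HV x : H x -> H x^-1%g by move=> hx; rewrite -[x^-1%g]mul1g; exact: HM.
elim/in_parab_ind: h => [//|s x sK _ hx].
by rewrite -(invgK x); apply: HM; [apply: HK; exists s | exact: HV].
Qed.

Definition supported K v := forall t, t \notin K -> v t = 0.

Lemma root_supported K s : s \in K -> supported K (root s).
Proof. by move=> sK t tK; rewrite /vroot (_ : (t == s) = false) //; apply: contraNF tK => /eqP ->. Qed.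

Lemma act_notin K x v t : in_parab K x -> t \notin K -> act x v t = v t.
Proof.
move=> hx tK; elim/in_parab_ind: hx v => [|s y sK _ IH] v; first by rewrite act1.
rewrite actM act_gen /refl {1}/lincomb (root_supported sK tK) mulr0 addr0 mul1r.
exact: IH.
Qed.

Lemma act_supported K x v : in_parab K x -> supported K v -> supported K (act x v).
Proof. by move=> hx hv t tK; rewrite (act_notin _ hx tK) hv. Qed.

Lemma act_cone K w v : (forall s, s \in K -> nonneg (act w (root s))) ->
  supported K v -> nonneg v -> nonneg (act w v).
Proof.
move=> h hv pv t; rewrite act_expand sumr_ge0 // => s _.
have [sK|sK] := boolP (s \in K); first by rewrite mulr_ge0 // h.
by rewrite (hv _ sK) mul0r.
Qed.

Lemma act_cone_opp K w v : (forall s, s \in K -> nonpos (act w (root s))) ->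
  supported K v -> nonneg v -> nonpos (act w v).
Proof.
move=> h hv pv t; rewrite act_expand sumr_le0 // => s _.
have [sK|sK] := boolP (s \in K); first by rewrite mulr_ge0_le0 // h.
by rewrite (hv _ sK) mul0r.
Qed.

Lemma act_nonpos_cone K w v : (forall s, s \in K -> nonneg (act w (root s))) ->
  supported K v -> nonpos v -> nonpos (act w v).
Proof.
move=> h hv pv t; rewrite act_expand sumr_le0 // => s _.
have [sK|sK] := boolP (s \in K); first by rewrite mulr_le0_ge0 // h.
by rewrite (hv _ sK) mul0r.
Qed.

Lemma act_nonpos_cone_opp K w v : (forall s, s \in K -> nonpos (act w (root s))) ->
  supported K v -> nonpos v -> nonneg (act w v).
Proof.
move=> h hv pv t; rewrite act_expand sumr_ge0 // => s _.
have [sK|sK] := boolP (s \in K); first by rewrite mulr_le0 // h.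
by rewrite (hv _ sK) mul0r.
Qed.

(** The inverse of w keeps the sign of vectors supported on K, so an s in K is a descent of x w
    exactly when it is one of x. *)
Lemma len_parab_min K w x : (forall s, s \in K -> ~~ desc s w) -> in_parab K x ->
  len (x * w)%g = (len x + len w)%N.
Proof.
move=> hw; elim/in_parab_ind => [|s x' sK hx' IH]; first by rewrite len1 mul1g.
have sup : supported K (act x'^-1%g (root s)).
  by apply: act_supported (root_supported sK); exact: in_parabV.
have cone s' : s' \in K -> nonneg (act w^-1%g (root s')).
  by move=> /hw; exact: ndesc_nonneg.
rewrite -mulgA; have [d|d] := boolP (desc s x').
  have /len_desc e1 : desc s (x' * w)%g.
    apply: nonpos_desc; rewrite invgM actM.
    exact: act_nonpos_cone cone sup (desc_nonpos d).
  by have e2 := len_desc d; apply: succn_inj; rewrite -e1 IH e2 addSn.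
have /len_ndesc e1 : ~~ desc s (x' * w)%g.
  by apply: nonneg_ndesc; rewrite invgM actM; apply: act_cone cone sup (ndesc_nonneg d).
by rewrite e1 IH (len_ndesc d) addSn.
Qed.

(** Dual to [len_parab_min]: the inverse of w reverses signs on K, so each letter that lengthens x
    shortens x w. *)
Lemma len_parab_max K w x : (forall s, s \in K -> desc s w) -> in_parab K x ->
  (len (x * w)%g + len x)%N = len w.
Proof.
move=> hw; elim/in_parab_ind => [|s x' sK hx' IH]; first by rewrite len1 mul1g addn0.
have sup : supported K (act x'^-1%g (root s)).
  by apply: act_supported (root_supported sK); exact: in_parabV.
have cone s' : s' \in K -> nonpos (act w^-1%g (root s')).
  by move=> /hw; exact: desc_nonpos.
rewrite -mulgA; have [d|d] := boolP (desc s x').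
  have /len_ndesc e1 : ~~ desc s (x' * w)%g.
    by apply: nonneg_ndesc; rewrite invgM actM; apply: act_nonpos_cone_opp cone sup (desc_nonpos d).
  by rewrite e1 addSn -addnS -(len_desc d) IH.
have /len_desc e1 : desc s (x' * w)%g.
  by apply: nonpos_desc; rewrite invgM actM; apply: act_cone_opp cone sup (ndesc_nonneg d).
by rewrite (len_ndesc d) addnS -addSn -e1 IH.
Qed.

(** Otherwise the lengths of the inverse of x and of x would add up to the length of 1. *)
Lemma parab_desc K x : in_parab K x -> x != 1%g -> exists2 s, s \in K & desc s x.
Proof.
move=> hx /eqP x1; apply: contrapT => nex; apply: x1; apply: len_eq0.
have := @len_parab_min K x x^-1%g _ (in_parabV hx).
rewrite mulVg len1 => /(_ _)/esym/eqP; rewrite addn_eq0 => h; apply/eqP.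
suff /h /andP[] : forall s, s \in K -> ~~ desc s x by [].
by move=> s sK; apply/negP => d; apply: nex; exists s.
Qed.

Lemma parab_finite_bounded K N :
  (forall x, in_parab K x -> (len x <= N)%N) -> finite_set (parabolic r K).
Proof.
move=> h; apply: (@sub_finite_set _ _ (range (fun c : N.-bseq T => ev c))).
  move=> x /parabolicE /h; have [c <- <-] := reduced_word x => hc.
  by exists (Bseq hc).
exact: finite_image.
Qed.

(** The length of w bounds all lengths in the parabolic subgroup, and there are finitely many words
    of bounded size. *)
Lemma desc_parab_finite K w : (forall s, s \in K -> desc s w) -> finite_set (parabolic r K).
Proof.
move=> h; apply: (@parab_finite_bounded K (len w)) => x hx.
by have := len_parab_max h hx; lia.
Qed.

(** * The longest element of a finite parabolic subgroup *)

Section Longest.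
Variable K : {set T}.
Hypothesis finK : finite_set (parabolic r K).
Local Notation wK := (longest r K).

Lemma longest_is_longest : is_longest r K wK.
Proof.
rewrite /longest; set A := [set w | _]%classic.
apply: (xgetPex 1%g (P := A)); rewrite /A /=.
have [l hl] := (finite_seqP _).1 finK.
pose P n := `[< exists2 w, in_parab K w & len w = n >].
have ex : exists n, P n by exists 0%N; apply/asboolP; exists 1%g; [exact: in_parab1|exact: len1].
have ub n : P n -> (n <= \max_(x <- l) len x)%N.
  move=> /asboolP[w /parabolicE hw <-].
  have wl : w \in l by move: hw; rewrite hl.
  exact: leq_bigmax_seq.
case: (ex_maxnP ex ub) => n /asboolP[w hw <-] hmax.
exists w; split; first exact/parabolicE.
by move=> y /parabolicE hy; apply: hmax; apply/asboolP; exists y.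
Qed.

Lemma longest_in : in_parab K wK.
Proof. by apply/parabolicE; case: longest_is_longest. Qed.

Lemma longest_max x : in_parab K x -> (len x <= len wK)%N.
Proof. by move/parabolicE; case: longest_is_longest => _; apply. Qed.

Lemma max_desc x s : in_parab K x -> len x = len wK -> s \in K -> desc s x.
Proof.
move=> hx ex sK; apply/negPn/negP => /len_ndesc e.
have /longest_max : in_parab K (r s * x)%g by apply: in_parabM => //; exact: in_parab_gen.
by rewrite e ex ltnn.
Qed.

Lemma longest_desc s : s \in K -> desc s wK.
Proof. by move=> sK; apply: max_desc => //; exact: longest_in. Qed.

(** By [len_parab_max] in both directions, the length d of x / wK satisfies len wK + d = len x and
    len x + d = len wK. *)
Lemma longest_unique x : in_parab K x -> (forall s, s \in K -> desc s x) -> x = wK.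
Proof.
move=> hx dx; have hK := longest_in.
have h1 := len_parab_max dx (in_parabM hK (in_parabV hx)).
have h2 := len_parab_max longest_desc (in_parabM hx (in_parabV hK)).
move: h1 h2; rewrite -!mulgA !mulVg !mulg1 => h1 h2.
have e : len (x / wK)%g = len (wK / x)%g by rewrite -len_invg invgM invgK.
have /len_eq0 /divg1_eq // : len (x / wK)%g = 0%N by lia.
Qed.

Lemma longestV : (wK^-1 = wK)%g.
Proof.
apply: longest_unique; first exact: in_parabV longest_in.
by move=> s sK; apply: max_desc => //; rewrite ?len_invg //; exact: in_parabV longest_in.
Qed.

Lemma longest_sq : (wK * wK = 1)%g.
Proof. by rewrite -{1}longestV mulVg. Qed.

Lemma len_longest_desc w : (forall s, s \in K -> desc s w) ->
  len w = (len wK + len (wK * w)%g)%N.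
Proof. by move=> h; rewrite -(len_parab_max h longest_in) addnC. Qed.

Lemma longest_neq1 s : s \in K -> (0 < len wK)%N.
Proof. by move=> /longest_desc/len_desc ->. Qed.

End Longest.

(** * Orbits of simple reflections *)

Section Twisted.
Variables (tau : {multiplicative W -> W}) (p : T -> T).
Hypothesis tau_inj : injective tau.
Hypothesis tau_gen : forall s, tau (r s) = r (p s).

Lemma p_inj : injective p.
Proof. by move=> s t e; apply/gen_inj/tau_inj; rewrite !tau_gen e. Qed.

Lemma tau_word c : tau (ev c) = ev (map p c).
Proof.
elim: c => [|s c IH]; first by rewrite !word_nil morph1.
by rewrite /= !word_cons gmulfM IH tau_gen.
Qed.

(** Labels are the orders of products of two generators, and the injective [tau] preserves
    orders. *)
Lemma label_p s t : m (p s) (p t) = m s t.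
Proof.
have rel s' t' : ((r s' * r t') ^+ m s' t' = 1)%g by case: pres.
apply/eqP; rewrite eqn_dvd; apply/andP; split; apply: gen_order; last first.
  by apply: tau_inj; rewrite morphX gmulfM !tau_gen rel morph1.
by rewrite -!tau_gen -gmulfM -morphX rel morph1.
Qed.

Lemma coroot_p s v : coroot (p s) v = coroot s (v \o p).
Proof.
rewrite /coroot (reindex_inj p_inj) /=; apply: eq_bigr => u _.
by rewrite label_p.
Qed.

(** Holds because the form is invariant under [p]. Consequently elements fixed by [tau] preserve the
    space of [p]-invariant vectors. *)
Lemma act_p w v : act w (v \o p) = act (tau w) v \o p.
Proof.
have [c <-] := words w; rewrite tau_word; elim: c => [|s c IH].
  by rewrite !word_nil !act1.
rewrite /= !word_cons !actM !act_gen IH; apply/funext => t.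
by rewrite /refl /lincomb /= coroot_p /vroot (inj_eq p_inj).
Qed.

Lemma len_tau w : len (tau w) = len w.
Proof.
apply/eqP; rewrite eqn_leq; apply/andP; split.
  by have [c <- <-] := reduced_word w; rewrite tau_word -(size_map p) len_le.
have [d <- ed] := reduced_word (tau w).
have <- : ev (map (invF p_inj) d) = w.
  by apply: tau_inj; rewrite tau_word -ed -map_comp (eq_map (f_invF p_inj)) map_id.
by rewrite (leq_trans (len_le _)) ?size_map.
Qed.

Lemma desc_tau s w : desc (p s) (tau w) = desc s w.
Proof. by rewrite /desc -tau_gen -gmulfM !len_tau. Qed.

Lemma tau_orbitE s t : (t \in tau_orbit r tau s) = fconnect p s t.
Proof.
have it n : iter n tau (r s) = r (iter n p s) by elim: n => //= n ->; rewrite tau_gen.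
rewrite inE; apply/asboolP/idP => [[n] | /iter_findex e].
  by rewrite it => /gen_inj <-; exact: fconnect_iter.
by exists (findex p s t); rewrite it e.
Qed.

Definition orbit_set I := exists s, I = tau_orbit r tau s.

Lemma orbit_p I s : orbit_set I -> (p s \in I) = (s \in I).
Proof.
by case=> t ->; rewrite !tau_orbitE -(same_fconnect1_r p_inj).
Qed.

Lemma orbit_const (X : Type) (f : T -> X) I : orbit_set I -> (forall s, f (p s) = f s) ->
  {in I &, forall s t, f s = f t}.
Proof.
case=> u -> fp.
suff h s : s \in tau_orbit r tau u -> f s = f u by move=> s t /h -> /h ->.
rewrite tau_orbitE => /iter_findex <-.
by elim: (findex p u s) => //= n IH; rewrite fp.
Qed.

Lemma orbit_eq I J s : orbit_set I -> orbit_set J -> s \in I -> s \in J -> I = J.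
Proof.
move=> [u ->] [u' ->]; rewrite !tau_orbitE => h h'; apply/setP => t.
rewrite !tau_orbitE; apply: same_connect; first exact: fconnect_sym p_inj.
by apply: connect_trans h _; rewrite fconnect_sym //; exact: p_inj.
Qed.

Lemma orbit_nonempty I : orbit_set I -> exists s, s \in I.
Proof. by case=> s ->; exists s; rewrite tau_orbitE. Qed.

Lemma orbit_desc I w s t : orbit_set I -> tau w = w -> s \in I -> t \in I ->
  desc s w -> desc t w.
Proof.
move=> oI tw sI tI.
by rewrite (orbit_const oI (f := desc^~ w) _ sI tI) // => u; rewrite -{1}tw desc_tau.
Qed.

Lemma tau_longest K : finite_set (parabolic r K) -> (forall s, (p s \in K) = (s \in K)) ->
  tau (longest r K) = longest r K.
Proof.
move=> fK pK; apply: longest_unique => //.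
  have [c hc <-] := longest_in fK; rewrite tau_word; exists (map p c) => //.
  by rewrite all_map; apply: sub_all hc => s /=; rewrite pK.
move=> s; rewrite -(f_invF p_inj s) pK => sK; rewrite desc_tau.
exact: longest_desc.
Qed.

(** * Invariant vectors and sums of simple roots over orbits *)

Definition p_inv v := forall s, v (p s) = v s.
Definition ind (I : {set T}) : T -> R := fun t => (t \in I)%:R.

Lemma p_invE v : p_inv v -> v \o p = v.
Proof. by move=> h; apply/funext. Qed.

Lemma act_p_inv w v : tau w = w -> p_inv v -> p_inv (act w v).
Proof.
by move=> tw /p_invE h s; rewrite -[RHS](congr1 (@^~ s) (congr1 (act w) h)) act_p tw.
Qed.

Lemma coroot_p_inv s v : p_inv v -> coroot (p s) v = coroot s v.
Proof. by rewrite coroot_p => /p_invE ->. Qed.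

Lemma ind_p_inv I : orbit_set I -> p_inv (ind I).
Proof. by move=> oI s; rewrite /ind orbit_p. Qed.

Lemma ind_supported I : supported I (ind I).
Proof. by move=> t /negbTE h; rewrite /ind h. Qed.

Lemma ind_nonneg I : nonneg (ind I).
Proof. by move=> t; rewrite /ind ler0n. Qed.

Lemma p_inv_ind I s v : orbit_set I -> s \in I -> p_inv v -> supported I v ->
  v = fun t => v s * ind I t.
Proof.
move=> oI sI iv sv; apply/funext => t; rewrite /ind; have [tI|tI] := boolP (t \in I).
  by rewrite mulr1; exact: (orbit_const oI iv).
by rewrite sv // mulr0.
Qed.

Lemma longest_nonpos K s : finite_set (parabolic r K) -> s \in K ->
  nonpos (act (longest r K) (root s)).
Proof. by move=> fK sK; rewrite -(longestV fK); apply/desc_nonpos/longest_desc. Qed.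

(** Invariant vectors supported on one orbit form a line, on which the longest element acts by a
    scalar k with k^2 = 1 and k <= 0. *)
Lemma act_longest_ind I : orbit_set I -> finite_set (parabolic r I) ->
  act (longest r I) (ind I) = fun t => - ind I t.
Proof.
move=> oI fI; have [s sI] := orbit_nonempty oI.
set w := longest r I; have hw : in_parab I w by exact: longest_in.
have tw : tau w = w by apply: tau_longest => // u; exact: orbit_p.
have e := p_inv_ind oI sI (act_p_inv tw (ind_p_inv oI))
  (act_supported hw (@ind_supported I)).
have le0 : act w (ind I) s <= 0.
  by apply: (act_cone_opp _ (@ind_supported I) (@ind_nonneg I)) => u; exact: longest_nonpos.
move: e le0; move: (act w (ind I) s) => k e le0.
have : act w (act w (ind I)) s = ind I s by rewrite -actM longest_sq ?act1.
rewrite e act_scale e /ind sI /= => kk.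
have -> : k = -1 by nra.
by apply/funext => t; rewrite mulN1r.
Qed.

Lemma act_fix K x v : (forall s, s \in K -> coroot s v = 0) -> in_parab K x -> act x v = v.
Proof.
move=> h; elim/in_parab_ind => [|s y sK _ IH]; first exact: act1.
by rewrite actM IH act_gen refl_fix ?h.
Qed.

(* A nonzero vector of the closed antidominant cone would only grow under W_K,
   whereas the longest element makes every nonnegative vector nonpositive. *)
Lemma antidominant_eq0 K v : finite_set (parabolic r K) -> supported K v -> nonneg v ->
  (forall s, s \in K -> coroot s v <= 0) -> v = fun=> 0.
Proof.
move=> fK sv pv hv.
have grow n x : (len x <= n)%N -> in_parab K x -> forall t, v t <= act x^-1%g v t.
  elim: n x => [|n IH] x lx hx t.
    have -> : x = 1%g by apply: len_eq0; apply/eqP; rewrite -leqn0.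
    by rewrite invg1 act1.
  have [->|x1] := eqVneq x 1%g; first by rewrite invg1 act1.
  have [s sK ds] := parab_desc hx x1; pose y := (r s * x)%g.
  have ex : x = (r s * y)%g by rewrite genK.
  have hy : in_parab K y by apply: in_parabM => //; exact: in_parab_gen.
  have ly : (len y <= n)%N by have := len_desc ds; rewrite -/y => e; rewrite -ltnS -e.
  apply: le_trans (IH y ly hy t) _.
  have nd : ~~ desc s y by rewrite desc_gen ds.
  clearbody y; rewrite ex invgM gen_inv actM act_gen /refl act_lincomb /lincomb /= mul1r.
  rewrite lerDl mulr_ge0 ?(ndesc_nonneg nd) // oppr_ge0 pmulr_rle0 ?hv //; lra.
apply: nonneg_nonpos0 => // t; apply: le_trans (grow _ _ (leqnn _) (longest_in fK) t) _.
rewrite longestV //; apply: act_cone_opp sv pv t => s; exact: longest_nonpos.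
Qed.

(** The value is the same at all points of the orbit, so if it were not positive the orbit sum would
    be antidominant, hence zero. *)
Lemma coroot_ind_gt0 (I : {set T}) s : orbit_set I -> finite_set (parabolic r I) -> s \in I ->
  0 < coroot s (ind I).
Proof.
move=> oI fI sI; rewrite ltNge; apply/negP => le0.
have /(congr1 (@^~ s)) : ind I = fun=> 0.
  apply: antidominant_eq0 fI (@ind_supported I) (@ind_nonneg I) _ => t tI.
  rewrite -(orbit_const oI (f := fun u => coroot u (ind I)) _ sI tI) // => u.
  by apply: coroot_p_inv; exact: ind_p_inv.
by rewrite /ind sI => /eqP; rewrite oner_eq0.
Qed.

Lemma coroot_sum (I J : {set T}) : \sum_(s in I) coroot s (ind J) = \sum_(t in J) coroot t (ind I).
Proof.
have e (K : {set T}) s : coroot s (ind K) = \sum_(t in K) - cosl R (m t s).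
  rewrite /coroot [RHS]big_mkcond; apply: eq_bigr => u _; rewrite /ind.
  by case: ifP => _; rewrite ?mul1r ?mul0r.
under eq_bigr => s _ do rewrite e; under [RHS]eq_bigr => s _ do rewrite e.
rewrite exchange_big.
by apply: eq_bigr => t _; apply: eq_bigr => s _; case: hm => _ ->.
Qed.

Lemma coroot_orbit I J s t : orbit_set I -> orbit_set J -> s \in I -> t \in I ->
  coroot s (ind J) = coroot t (ind J).
Proof.
move=> oI oJ sI tI; apply: (orbit_const oI (f := fun u => coroot u (ind J))) => // u.
by apply: coroot_p_inv; exact: ind_p_inv.
Qed.

Lemma coroot_card I J s t : orbit_set I -> orbit_set J -> s \in I -> t \in J ->
  #|I|%:R * coroot s (ind J) = #|J|%:R * coroot t (ind I).
Proof.
move=> oI oJ sI tJ; have := coroot_sum I J.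
rewrite (eq_bigr (fun=> coroot s (ind J))) => [|u uI]; last exact: (coroot_orbit oI oJ uI sI).
rewrite [RHS](eq_bigr (fun=> coroot t (ind I))) => [|u uI]; last exact: (coroot_orbit oJ oI uI tJ).
by rewrite !sumr_const !mulr_natl.
Qed.

Section TwoOrbits.
Variables (I J : {set T}) (s0 t0 : T).
Hypotheses (oI : orbit_set I) (oJ : orbit_set J).
Hypotheses (fI : finite_set (parabolic r I)) (fJ : finite_set (parabolic r J)).
Hypotheses (s0I : s0 \in I) (t0J : t0 \in J) (IJ : I != J).
Local Notation wI := (longest r I).
Local Notation wJ := (longest r J).

Lemma orbits_disjoint s : s \in I -> s \notin J.
Proof. by move=> sI; apply: contra IJ => sJ; apply/eqP; exact: orbit_eq sI sJ. Qed.

Lemma coroot_cross_le0 s : s \in I -> coroot s (ind J) <= 0.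
Proof.
move=> sI; rewrite /coroot; apply: sumr_le0 => u _; rewrite /ind.
have [uJ|_] := boolP (u \in J); last by rewrite mul0r.
rewrite mul1r oppr_le0 cosl_ge0 //; case: hm => _ _; apply.
by apply: contraNneq (orbits_disjoint sI) => <-.
Qed.

(** A multiple of [ind I] is added to [ind J] to make it orthogonal to every root of I, hence fixed
    by [wI]. So [wI] acts on the plane of the two orbit sums as the reflection in [ind I]. *)
Lemma act_longest_cross :
  act wI (ind J) =
  lc (- (2 * coroot s0 (ind J)) / coroot s0 (ind I)) (ind I) 1 (ind J).
Proof.
have b0 : coroot s0 (ind I) != 0 by rewrite lt0r_neq0 // coroot_ind_gt0.
pose k := - coroot s0 (ind J) / coroot s0 (ind I).
have fixy : act wI (lc k (ind I) 1 (ind J)) = lc k (ind I) 1 (ind J).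
  apply: (@act_fix I); last exact: longest_in.
  move=> s sI; rewrite coroot_lincomb (coroot_orbit oI oI sI s0I) (coroot_orbit oI oJ sI s0I).
  by rewrite /k; field.
move: fixy; rewrite act_lincomb (act_longest_ind oI fI) => e.
apply/funext => t; have := congr1 (@^~ t) e; rewrite /lincomb /= => et.
have -> : act wI (ind J) t = 2 * k * ind I t + ind J t by lra.
by rewrite /k; field.
Qed.

(** Strict Cauchy-Schwarz for the two orbit sums, the cardinalities of the orbits cancelling. *)
Lemma cross_lt : finite_set (parabolic r (I :|: J)) ->
  coroot s0 (ind J) * coroot t0 (ind I) < coroot s0 (ind I) * coroot t0 (ind J).
Proof.
move=> fK; rewrite ltNge; apply/negP => le.
set bI := coroot s0 (ind I) in le *; set bJ := coroot t0 (ind J) in le *.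
set e := coroot s0 (ind J) in le *; set e' := coroot t0 (ind I) in le *.
have b0 : 0 < bI by exact: coroot_ind_gt0.
have e0 : e <= 0 by exact: coroot_cross_le0.
(* This vector is orthogonal to the roots of I, and if the inequality failed it would be
   antidominant on J as well; yet its coefficient at [t0] is [bI] > 0. *)
pose v := lc (- e) (ind I) bI (ind J).
have /(congr1 (@^~ t0)) : v = fun=> 0.
  apply: (antidominant_eq0 fK).
  - move=> t; rewrite finset.in_setU negb_or => /andP[tI tJ].
    by rewrite /v /lincomb (ind_supported tI) (ind_supported tJ) !mulr0 addr0.
  - by move=> t; rewrite /v /lincomb addr_ge0 // mulr_ge0 ?oppr_ge0 ?ind_nonneg // ltW.
  - move=> s; rewrite finset.in_setU => /orP[sI|sJ]; rewrite /v coroot_lincomb.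
      rewrite (coroot_orbit oI oI sI s0I) (coroot_orbit oI oJ sI s0I) -/bI -/e; lra.
    rewrite (coroot_orbit oJ oI sJ t0J) (coroot_orbit oJ oJ sJ t0J) -/bJ -/e'; lra.
rewrite /v /lincomb /ind t0J.
have /negbTE -> : t0 \notin I by apply: contraL t0J; exact: orbits_disjoint.
by rewrite mulr0 add0r mulr1; lra.
Qed.

End TwoOrbits.


(** The orbit sums A, D make an angle with squared cosine cos^2(pi/M). As B(A, A) and B(A, D) are
    #|I| times values of coroots at s, and B(D, D) and B(D, A) are #|J| times values at t, the
    cardinalities drop out. *)
Definition cross_angle (I J : {set T}) M := exists s t, [/\ s \in I, t \in J, (1 < M)%N &
  cosl R M ^+ 2 * (coroot s (ind I) * coroot t (ind J)) =
  coroot s (ind J) * coroot t (ind I)].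

Lemma cross_angleC I J M : cross_angle I J M -> cross_angle J I M.
Proof.
move=> [s [t [sI tJ M1 e]]]; exists t, s; split=> //.
by rewrite mulrC [RHS]mulrC -e mulrC [X in _ * X]mulrC.
Qed.

(** * The dihedral group generated by two longest elements *)

Section Rotation.
Variables (I J : {set T}) (M : nat).
Hypotheses (oI : orbit_set I) (oJ : orbit_set J).
Hypotheses (fI : finite_set (parabolic r I)) (fJ : finite_set (parabolic r J)).
Hypotheses (IJ : I != J) (angle : cross_angle I J M).
Local Notation wI := (longest r I).
Local Notation wJ := (longest r J).

(** The factor k rescales the second orbit sum to the norm of the first, which brings the two
    reflections to the standard form. *)
Lemma fold_dihedral_pair : exists2 k, 0 < k &
  dihedral_pair (cosl R M) (act wI) (act wJ) (ind I) (fun t => k * ind J t).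
Proof.
have JI : J != I by rewrite eq_sym.
have [s [t [sI tJ M1 ang]]] := angle; set c := cosl R M in ang *.
set bI := coroot s (ind I) in ang; set bJ := coroot t (ind J) in ang.
set e := coroot s (ind J) in ang; set e' := coroot t (ind I) in ang.
have bI0 : 0 < bI by exact: coroot_ind_gt0.
have bJ0 : 0 < bJ by exact: coroot_ind_gt0.
have e0 : e <= 0 by apply: coroot_cross_le0 sI.
have e'0 : e' <= 0 by apply: coroot_cross_le0 tJ.
have c0 : 0 <= c by apply: cosl_ge0; case: (M) M1 => [|[]].
have cI : 0 < #|I|%:R :> R by rewrite ltr0n; apply/card_gt0P; exists s.
have cJ : 0 < #|J|%:R :> R by rewrite ltr0n; apply/card_gt0P; exists t.
have ce : #|I|%:R * e = #|J|%:R * e' by exact: coroot_card.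
have fA := act_longest_ind oI fI; have gB := act_longest_ind oJ fJ.
have fB := act_longest_cross oI oJ fI sI; have gA := act_longest_cross oJ oI fJ tJ.
rewrite -/e -/bI in fB; rewrite -/e' -/bJ in gA.
have suff_k k : 0 < k -> k * (- (2 * e) / bI) = 2 * c -> - (2 * e') / bJ = 2 * c * k ->
    dihedral_pair c (act wI) (act wJ) (ind I) (fun t => k * ind J t).
  move=> k0 e1 e2; split=> x y; rewrite act_lincomb act_scale.
    rewrite fA fB; apply/funext => u; rewrite /lincomb.
    transitivity (- x * ind I u + y * (k * (- (2 * e) / bI)) * ind I u +
      y * (k * ind J u)); first by ring.
    by rewrite e1; ring.
  by rewrite gA gB e2; apply/funext => u; rewrite /lincomb; ring.
have [ee|ee] := eqVneq e 0.
  have e'e : e' = 0.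
    by move: ce; rewrite ee mulr0 => /esym/eqP; rewrite mulf_eq0 (gt_eqF cJ) => /eqP.
  have cc : c = 0.
    move/eqP: ang.
    by rewrite ee mul0r mulf_eq0 (gt_eqF (mulr_gt0 bI0 bJ0)) orbF sqrf_eq0 => /eqP.
  exists 1 => //; apply: suff_k => //; rewrite ?ee ?e'e cc; by rewrite mulr0 oppr0 mul0r ?mulr0 ?mul0r.
have elt : e < 0 by rewrite lt_neqAle ee.
have clt : 0 < c.
  rewrite lt_neqAle c0 andbT eq_sym; apply/eqP => cc.
  have e'n : e' < 0.
    have : #|J|%:R * e' < 0 by rewrite -ce nmulr_llt0.
    by rewrite pmulr_rlt0.
  have := ang; rewrite cc expr0n /= mul0r => /esym/eqP.
  by rewrite mulf_eq0 (lt_eqF elt) (lt_eqF e'n).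
have ne : e != 0 by []; have nI : bI != 0 by rewrite gt_eqF.
have nJ : bJ != 0 by rewrite gt_eqF.
(* Solves the first equation of [suff_k]; the second then is the angle hypothesis e e' = c^2 bI
   bJ. *)
exists (- (c * bI) / e).
  by rewrite mulNr -mulrN mulr_gt0 ?mulr_gt0 // oppr_gt0 invr_lt0.
apply: suff_k.
- by rewrite mulNr -mulrN mulr_gt0 ?mulr_gt0 // oppr_gt0 invr_lt0.
- by field; rewrite ne nI.
- apply: (mulIf nJ); apply: (mulIf ne).
  transitivity (- 2 * (e * e')); first by field.
  by rewrite -ang; field.
Qed.

Lemma tau_wI : tau wI = wI.
Proof. by apply: tau_longest => // s; exact: orbit_p. Qed.

Lemma tau_wJ : tau wJ = wJ.
Proof. by apply: tau_longest => // s; exact: orbit_p. Qed.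

Lemma orbit_desc_ind K s w : orbit_set K -> tau w = w -> s \in K -> desc s w ->
  nonpos (act w^-1%g (ind K)).
Proof.
move=> oK tw sK ds; apply: act_cone_opp (@ind_supported K) (@ind_nonneg K) => t tK.
exact/desc_nonpos/(orbit_desc oK tw sK tK).
Qed.

(** The power fixes both orbit sums. If it were not 1 it would have a descent in one of the orbits,
    hence the whole orbit as descents, and its inverse would make that orbit sum nonpositive. *)
Lemma longest_rotation : ((wI * wJ) ^+ M = 1)%g.
Proof.
have [k k0 pr] := fold_dihedral_pair.
have M1 : (1 < M)%N by case: angle => s [t []].
have [u0 u1] := cheb_period R M1; have [pI pJ] := dihedral_period pr u0 u1.
have it n v : act ((wI * wJ) ^+ n)%g v = iter n (act wI \o act wJ) v.
  by elim: n v => [|n IH] v; rewrite ?act1 // expgSr iterSr !actM IH.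
rewrite -!it act_scale in pI pJ; set x := (_ ^+ M)%g in pI pJ *.
have pJ' : act x (ind J) = ind J.
  by apply/funext => t; apply: (mulfI (lt0r_neq0 k0)); move/(congr1 (@^~ t)): pJ.
have tx : tau x = x by rewrite morphX gmulfM tau_wI tau_wJ.
apply/eqP/negPn/negP => x1.
have hx : in_parab (I :|: J) x.
  have h : in_parab (I :|: J) (wI * wJ)%g.
    apply: in_parabM.
      exact: in_parabS (finset.subsetUl _ _) (longest_in fI).
    exact: in_parabS (finset.subsetUr _ _) (longest_in fJ).
  by rewrite /x; elim: (M) => [|n IH]; [exact: in_parab1 | rewrite expgS; exact: in_parabM].
have bad K s : orbit_set K -> s \in K -> desc s x -> act x (ind K) = ind K -> False.
  move=> oK sK ds e; have := orbit_desc_ind oK tx sK ds s.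
  by rewrite -{1}e actK /ind sK ler10.
have [s sK ds] := parab_desc hx x1.
by move: sK; rewrite finset.in_setU => /orP[sK|sK]; [apply: (bad I s)|apply: (bad J s)].
Qed.

(** The inverse sends the sum over I to a combination of the orbit sums with Chebyshev coefficients
    of index at most j + 1 <= M, hence nonnegative. So one more factor [wI] adds its full length. *)
Lemma alt_longest_ndesc j s : (j < M)%N -> s \in I -> ~~ desc s (alt wJ wI j).
Proof.
move=> jM sI; have [k k0 pr] := fold_dihedral_pair.
have M1 : M != 1 by case: angle => s' [t []]; case: (M) => [|[]].
apply/negP => ds; set x := alt wJ wI j in ds.
have talt a b n : tau a = a -> tau b = b -> tau (alt a b n) = alt a b n.
  by elim: n a b => [|n IH] a b ta tb /=; rewrite ?morph1 // gmulfM ta IH.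
have tx : tau x = x by apply: talt; [exact: tau_wJ | exact: tau_wI].
have np := orbit_desc_ind oI tx sI ds.
have e : act x^-1%g (ind I) = alt_fun (act wJ) (act wI) j (ind I).
  rewrite /x; have inv n a b v : (a^-1 = a -> b^-1 = b ->
      act (alt a b n)^-1 v = alt_fun (act a) (act b) n v)%g.
    elim: n a b v => [|n IH] a b v ia ib /=; first by rewrite invg1 act1.
    by rewrite invgM actM ia IH.
  by apply: inv; exact: longestV.
have nn : nonneg (act x^-1%g (ind I)).
  rewrite e.
  have -> : ind I = lc (1 * cheb (cosl R M) 1) (ind I)
    (1 * cheb (cosl R M) 0) (fun t => k * ind J t).
    by rewrite /cheb mulr0 mulr1 lincomb10.
  rewrite (alt_fun_cheb _ _ _ pr) !mul1r add0n => t.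
  have u1 : 0 <= cheb (cosl R M) j by apply: cheb_ge0 => // _; exact: ltnW.
  have u2 : 0 <= cheb (cosl R M) j.+1 by apply: cheb_ge0.
  have kk := ltW k0.
  by case: ifP => _; rewrite /lincomb addr_ge0 // ?mulr_ge0 // ?mulr_ge0 // ind_nonneg.
have /act_eq0/(congr1 (@^~ s)) := nonneg_nonpos0 nn np.
by rewrite /ind sI => /eqP; rewrite oner_eq0.
Qed.

End Rotation.

(** * Identification of the folded matrix *)

(** Neighbours in the Coxeter graph; s itself is counted when it lies in J, its diagonal label being
    1. *)
Definition nbr (J : {set T}) s : {set T} := [set t in J | m t s != 2%N].

Lemma iter_p_surj n t : exists u, t = iter n p u.
Proof.
exists (iter n (invF p_inj) t); elim: n t => // n IH t.
by rewrite [iter n.+1 p _]iterS iterSr -IH f_invF.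
Qed.

Lemma card_nbr_p J s : orbit_set J -> #|nbr J (p s)| = #|nbr J s|.
Proof.
move=> oJ; rewrite -[RHS](card_imset _ p_inj); congr #|pred_of_set _|; apply/setP => t.
rewrite -(f_invF p_inj t); move: (invF p_inj t) => u.
rewrite (mem_imset _ _ p_inj) !inE orbit_p //.
by rewrite label_p.
Qed.

Lemma card_nbr (I J : {set T}) s t : orbit_set I -> orbit_set J -> s \in I -> t \in I ->
  #|nbr J s| = #|nbr J t|.
Proof.
move=> oI oJ; apply: (orbit_const oI (f := fun u => #|nbr J u|)) => u.
exact: card_nbr_p.
Qed.

Lemma coroot_nbr (J : {set T}) s : coroot s (ind J) = \sum_(t in nbr J s) - cosl R (m t s).
Proof.
rewrite /coroot [RHS]big_mkcond; apply: eq_bigr => t _; rewrite /ind inE.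
have [tJ|_] := boolP (t \in J); rewrite ?mul0r //= mul1r.
by case: eqVneq => //= ->; rewrite cosl2 oppr0.
Qed.

Lemma max_entry_le (I J : {set T}) n : (forall s t, s \in I -> t \in J -> (m s t <= n)%N) ->
  (max_entry m I J <= n)%N.
Proof. by move=> h; apply/bigmax_leqP => s sI; apply/bigmax_leqP => t tJ; exact: h. Qed.

Lemma max_entry_ge (I J : {set T}) s t : s \in I -> t \in J -> (m s t <= max_entry m I J)%N.
Proof.
move=> sI tJ; apply: leq_trans (leq_bigmax_cond _ sI).
exact: (@leq_bigmax_cond _ (mem J) (fun t => m s t)).
Qed.

Lemma max_entryC (I J : {set T}) : max_entry m I J = max_entry m J I.
Proof.
have ms s t : m s t = m t s by case: hm.
by apply/eqP; rewrite eqn_leq !max_entry_le // => s t sI tJ; rewrite ms max_entry_ge.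
Qed.

(** The map is an iterate of [p]; it carries label computations from one point of an orbit to
    another. *)
Lemma orbit_move (I : {set T}) s t : orbit_set I -> s \in I -> t \in I ->
  exists q : T -> T, [/\ q s = t, injective q,
    forall x y : T, m (q x) (q y) = m x y,
    (forall K (x : T), orbit_set K -> (q x \in K) = (x \in K)) &
    forall x : T, exists y : T, x = q y].
Proof.
case=> u -> ; rewrite !tau_orbitE => su tu.
have /iter_findex e : fconnect p s t.
  by apply: connect_trans tu; rewrite fconnect_sym //; exact: p_inj.
exists (iter (findex p s t) p); move: (findex p s t) e => n e; split => //.
- by elim: n {e} => //= n IH x y /p_inj /IH.
- by move=> x y; elim: n {e} => //= n IH; rewrite label_p.
- by move=> K x oK; elim: n {e} => //= n IH; rewrite orbit_p.
- exact: iter_p_surj.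
Qed.

Lemma label_offdiag s t : s != t -> m s t != 1%N.
Proof. by case: hm => _ _; exact. Qed.

Lemma label_sym s t : m s t = m t s.
Proof. by case: hm. Qed.

Lemma label_diag s : m s s = 1%N.
Proof. by case: hm. Qed.

(** A finite orbit is either a set of isolated vertices or a disjoint union of edges with one common
    label. The bound [<= 2] in the first case covers singletons, whose maximal entry is 1. *)
Lemma orbit_internal (I : {set T}) s : orbit_set I -> finite_set (parabolic r I) -> s \in I ->
  ((max_entry m I I <= 2)%N /\ coroot s (ind I) = 1 /\
     ((1 < #|I|)%N -> max_entry m I I = 2%N)) \/
  ((2 < max_entry m I I)%N /\ coroot s (ind I) = 1 - cosl R (max_entry m I I) /\
     (1 < #|I|)%N).
Proof.
move=> oI fI sI; have gt0 := coroot_ind_gt0 oI fI sI.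
have sN : s \in nbr I s by rewrite inE sI label_diag.
have e : coroot s (ind I) = 1 + \sum_(t in nbr I s :\ s) - cosl R (m t s).
  rewrite coroot_nbr (big_setD1 s sN) /= label_diag cosl1; ring.
have mv (u v : T) : u \in I -> v \in I -> u != v ->
    exists2 t, t \in I :\ s & m u v = m t s.
  move=> uI vI uv; have [q [qv qi qm qK _]] := orbit_move oI vI sI.
  exists (q u); last by rewrite -qv qm.
  by rewrite !inE -qv (inj_eq qi) uv qK.
have [N0|/set0Pn[t tN]] := eqVneq (nbr I s :\ s) finset.set0.
  left; have h2 (u v : T) : u \in I -> v \in I -> u != v -> m u v = 2%N.
    move=> uI vI uv; have [t] := mv u v uI vI uv.
    rewrite !inE => /andP[ts tI] ->; apply/eqP/negPn/negP => t2.
    have : t \in nbr I s :\ s by rewrite !inE ts tI.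
    by rewrite N0 inE.
  have le2 : (max_entry m I I <= 2)%N.
    apply: max_entry_le => u v uI vI; have [->|uv] := eqVneq u v.
      by rewrite label_diag.
    by rewrite h2.
  split=> //; split; first by rewrite e N0 big_set0 addr0.
  case/card_gt1P=> u [v [uI vI uv]]; apply/eqP; rewrite eqn_leq le2 /=.
  by rewrite -(h2 _ _ uI vI uv) max_entry_ge.
right; have := tN; rewrite !inE => /and3P[ts tI t2].
have half u : u \in nbr I s :\ s -> 1/2 <= cosl R (m u s).
  rewrite !inE => /and3P[us uI u2]; apply: cosl_ge_half => //; exact: label_offdiag.
(* Two neighbours would already bring the positive number [coroot s (ind I)] down to 1 - 1/2 - 1/2 =
   0. *)
have only u : u \in nbr I s :\ s -> u = t.
  move=> uN; apply/eqP/negPn/negP => ut; move: gt0; rewrite e.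
  rewrite (big_setD1 t tN) (big_setD1 u) /=; last by rewrite inE uN inE ut.
  set S := \sum_(_ in _) _; have : S <= 0.
    rewrite /S; apply: sumr_le0 => z; rewrite 3!inE => /and3P[_ _ /half h].
    by move: h; lra.
  by have := half _ tN; have := half _ uN; lra.
have e1 : coroot s (ind I) = 1 - cosl R (m t s).
  rewrite e (big_setD1 t tN) /= big1 ?addr0 // => u.
  by rewrite inE => /andP[ut /only ue]; move: ut; rewrite inE ue eqxx.
have n0 : m t s != 0%N.
  by apply/eqP => z; move: gt0; rewrite e1 z cosl0 subrr ltxx.
have n1 := label_offdiag ts.
have n3 : (2 < m t s)%N by move: n0 n1 t2; case: (m t s) => [|[|[]]].
have me : max_entry m I I = m t s.
  apply/eqP; rewrite eqn_leq max_entry_ge // andbT.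
  apply: max_entry_le => u v uI vI; have [->|uv] := eqVneq u v.
    by rewrite label_diag; case: (m t s) n0.
  have [z] := mv u v uI vI uv; rewrite !inE => /andP[zs zI] ->.
  have [->|z2] := eqVneq (m z s) 2%N; first exact: ltnW.
  by rewrite (only z) // !inE zs zI.
rewrite me; split=> //; split=> //; apply/card_gt1P; exists t, s; split=> //.
Qed.

Lemma is_folding_card k I J : is_folding r tau m k I J -> #|I| = (k * #|J|)%N.
Proof.
case=> u [uI fib _ _]; rewrite -sum1_card (partition_big u (mem J)) /=; last first.
  by move=> s sI; rewrite -uI; apply: imset_f.
rewrite (eq_bigr (fun=> k)) => [|t tJ]; first by rewrite sum_nat_const mulnC.
by rewrite -(fib t tJ) -sum1_card; apply: eq_bigl => s; rewrite inE.
Qed.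

(** * Pairs of orbits with a single neighbour on one side *)

Section OneNeighbour.
Variables (I J : {set T}) (s0 t0 : T).
Hypotheses (oI : orbit_set I) (oJ : orbit_set J).
Hypotheses (fI : finite_set (parabolic r I)) (fJ : finite_set (parabolic r J)).
Hypothesis fIJ : finite_set (parabolic r (I :|: J)).
Hypotheses (s0I : s0 \in I) (t0J : t0 \in J) (IJ : I != J).
Hypothesis nbr1 : #|nbr J s0| = 1%N.
Let mu := max_entry m I J.
Let b := #|nbr I t0|.

Lemma coroot_le1 (K : {set T}) s : orbit_set K -> finite_set (parabolic r K) -> s \in K ->
  coroot s (ind K) <= 1.
Proof.
move=> oK fK sK; case: (orbit_internal oK fK sK) => [[_ [-> _]]//|[h [-> _]]].
have : 0 <= cosl R (max_entry m K K) by apply: cosl_ge0; case: max_entry h => [|[]].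
lra.
Qed.

(** The folding map sends s to its only neighbour in J; uniqueness makes it commute with [p], and
    its fibres are the neighbour sets in I. *)
Lemma one_nbr_fold : [/\ (2 < mu)%N, is_folding r tau m b I J,
  coroot s0 (ind J) = - cosl R mu, coroot t0 (ind I) = - (b%:R * cosl R mu) &
  #|I| = (b * #|J|)%N].
Proof.
have u_ex s : s \in I -> exists t, nbr J s = [set t].
  by move=> sI; apply/cards1P; rewrite (card_nbr oI oJ sI s0I) nbr1.
pose u s := odflt s [pick t in nbr J s].
have uP s : s \in I -> nbr J s = [set u s].
  move=> /u_ex[t e]; rewrite /u e; case: pickP => [z|/(_ t)]; rewrite ?inE ?eqxx //.
  by move=> /eqP ->.
have uN s : s \in I -> u s \in nbr J s by move=> sI; rewrite uP // inE.
have uJ s : s \in I -> u s \in J by move/uN; rewrite inE => /andP[].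
have u2 s : s \in I -> m (u s) s != 2%N by move/uN; rewrite inE => /andP[].
have uniq_u s t : s \in I -> t \in J -> m t s != 2%N -> t = u s.
  by move=> sI tJ t2; apply/eqP; rewrite -finset.in_set1 -uP // inE tJ.
have disj s t : s \in I -> t \in J -> s != t.
  by move=> sI tJ; apply: contraTneq tJ => <-; exact: (orbits_disjoint oI oJ IJ sI).
pose n := m (u s0) s0.
have lab s : s \in I -> m (u s) s = n.
  move=> sI; have [q [qs _ qm qK _]] := orbit_move oI s0I sI.
  rewrite -(uniq_u s (q (u s0)) sI).
  - by rewrite -[X in m _ X]qs qm.
  - by rewrite qK // uJ.
  - by rewrite -[X in m _ X]qs qm u2.
have e1 : coroot s0 (ind J) = - cosl R n by rewrite coroot_nbr uP // big_set1.
have nI t : t \in J -> nbr I t = [set s in I | u s == t].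
  move=> tJ; apply/setP => s; rewrite !inE; have [sI|//] := boolP (s \in I).
  apply/idP/eqP => [h|<-]; last by rewrite label_sym u2.
  by apply/esym/uniq_u => //; rewrite label_sym.
have e2 : coroot t0 (ind I) = - (b%:R * cosl R n).
  rewrite coroot_nbr (eq_bigr (fun=> - cosl R n)) => [|s].
    by rewrite sumr_const mulNrn mulr_natl.
  by rewrite nI // inE => /andP[sI /eqP ut]; rewrite -ut label_sym lab.
have lt := cross_lt oI oJ fI s0I t0J IJ fIJ.
have bI1 := coroot_le1 oI fI s0I; have bJ1 := coroot_le1 oJ fJ t0J.
have bI0 := coroot_ind_gt0 oI fI s0I; have bJ0 := coroot_ind_gt0 oJ fJ t0J.
have n1 : n != 1%N by rewrite /n label_offdiag // eq_sym disj // uJ.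
have c2 : 1/2 <= cosl R n by apply: cosl_ge_half => //; exact: u2.
have cI : (0 < #|I|)%N by apply/card_gt0P; exists s0.
have cc : #|I| = (b * #|J|)%N.
  have := coroot_card oI oJ s0I t0J; rewrite e1 e2 => h.
  have c0 : cosl R n != 0 by rewrite gt_eqF //; lra.
  apply/eqP; rewrite -(eqr_nat R) natrM; apply/eqP/(mulIf c0).
  by move: h; rewrite !mulrN => /oppr_inj ->; ring.
have b0 : (0 < b)%N by move: cI; rewrite cc; case: (b).
(* An infinite label has cosine 1, so the product of the cross terms would be b >= 1, contradicting
   [cross_lt]. *)
have n0 : n != 0%N.
  apply/eqP => n0; move: lt; rewrite e1 e2 n0 cosl0.
  have : 1 <= b%:R :> R by rewrite ler1n.
  by nra.
have n3 : (2 < n)%N by have := u2 _ s0I; rewrite -/n; move: n0 n1; case: (n) => [|[|[]]].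
have me : mu = n.
  apply/eqP; rewrite eqn_leq; apply/andP; split; last first.
    by rewrite /n label_sym; apply: max_entry_ge => //; exact: uJ.
  apply: max_entry_le => s t sI tJ; rewrite label_sym.
  have [->|h] := eqVneq (m t s) 2%N; first exact: ltnW.
  by rewrite (uniq_u s t) // lab.
have card_fib t : t \in J -> #|[set s in I | u s == t]| = b.
  by move=> tJ; rewrite -nI //; exact: (card_nbr oJ oI tJ t0J).
rewrite me; split=> //; exists u; split=> //.
- apply/setP => t; apply/imsetP/idP => [[s sI ->]|tJ]; first exact: uJ.
  have /card_gt0P[s] : (0 < #|[set s in I | u s == t]|)%N by rewrite card_fib.
  by rewrite inE => /andP[sI /eqP <-]; exists s.
- move=> s s' sI s'I; rewrite !tau_gen => /gen_inj <-; congr (r _).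
  by apply: uniq_u; rewrite ?orbit_p ?uJ ?label_p ?u2.
- move=> s t sI tJ; rewrite -/mu me label_sym; case: eqVneq => [->|h]; first exact: lab.
  by apply/eqP/negPn/negP => h2; move: h; rewrite (uniq_u s t) ?eqxx.
Qed.

End OneNeighbour.

Local Notation node := (folded_node r tau).
Local Notation fmx := (@folded_matrix T W r tau m).

Lemma node_orbit (I : node) : orbit_set (val I).
Proof. by have /andP[/existsP[s /eqP e] _] := valP I; exists s. Qed.

Lemma node_finite (I : node) : finite_set (parabolic r (val I)).
Proof. by have /andP[_ /asboolP] := valP I. Qed.

Lemma foldingC k I J : folding r tau m k I J = folding r tau m k J I.
Proof. by rewrite /folding; apply: asbool_equiv_eq; tauto. Qed.

Lemma folded_matrixC (I J : node) : fmx I J = fmx J I.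
Proof.
rewrite /folded_matrix (eq_sym I J) (finset.setUC (val I)) (max_entryC (val I) (val J)).
rewrite !(foldingC _ (val I) (val J)).
set a := max_entry _ (val I) (val I); set b := max_entry _ (val J) (val J).
have sw (x y : nat) : ((a, b) \in [:: (x, y); (y, x)]) = ((b, a) \in [:: (x, y); (y, x)]).
  by rewrite !inE !xpair_eqE orbC; congr orb; rewrite andbC.
by rewrite (sw 4%N 2%N) (sw 3%N 2%N) [(a <= 2)%N && _]andbC.
Qed.

Lemma folded_matrix_diag (I : node) : fmx I I = 1%N.
Proof. by rewrite /folded_matrix eqxx. Qed.

(** Case analysis on the degree b of the folding, driven by b cos^2(pi/mu) < B_I B_J <= 1, where B_I
    and B_J are 1, or 1 minus the cosine of the inner label. In each case the ratio of the two sides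
    is cos^2(pi/M). *)
Lemma one_nbr_angle (I J : node) s0 : I != J ->
  finite_set (parabolic r (val I :|: val J)) ->
  s0 \in val I -> #|nbr (val J) s0| = 1%N -> cross_angle (val I) (val J) (fmx I J).
Proof.
move=> IJ fIJ s0I nbr1; have oI := node_orbit I; have oJ := node_orbit J.
have fI := node_finite I; have fJ := node_finite J.
have [t0 t0J] := orbit_nonempty oJ.
have vIJ : val I != val J by [].
have lt := cross_lt oI oJ fI s0I t0J vIJ fIJ.
have [mu3 fold e1 e2 cc] := one_nbr_fold oI oJ fI fJ fIJ s0I t0J vIJ nbr1.
have iI := orbit_internal oI fI s0I; have iJ := orbit_internal oJ fJ t0J.
have cI : (0 < #|val I|)%N by apply/card_gt0P; exists s0.
have cJ : (0 < #|val J|)%N by apply/card_gt0P; exists t0.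
have mu1 : max_entry m (val I) (val J) != 1%N by case: max_entry mu3 => [|[]].
have mu2 : max_entry m (val I) (val J) != 2%N by case: max_entry mu3 => [|[|[]]].
have cmu := cosl_ge_half R mu1 mu2.
have cmu3 : max_entry m (val I) (val J) = 3%N -> cosl R (max_entry m (val I) (val J)) = 1/2.
  by move=> ->; exact: cosl3.
have cmu4 : max_entry m (val I) (val J) != 3%N ->
    1/2 <= cosl R (max_entry m (val I) (val J)) ^+ 2.
  by move=> h; apply: cosl_ge4; rewrite ltn_neqAle eq_sym h.
have b0 : (0 < #|nbr (val I) t0|)%N by move: cI; rewrite cc; case: #|nbr _ _|.
(* Counting elements determines the degree; a folding in the opposite direction forces k b = 1. *)
have foldE k : (0 < k)%N -> folding r tau m k (val I) (val J) = (k == #|nbr (val I) t0|).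
  move=> k0; apply/asboolP/eqP => [[] /is_folding_card|->]; last by left.
    by rewrite cc => /eqP; rewrite eqn_pmul2r // => /eqP ->.
  rewrite cc mulnA => /eqP; rewrite -{1}(mul1n #|val J|) eqn_pmul2r // => /eqP e.
  by have := muln_eq1 k #|nbr (val I) t0|; rewrite -e eqxx => /esym/andP[/eqP -> /eqP ->].
have bI1 := coroot_le1 oI fI s0I; have bJ1 := coroot_le1 oJ fJ t0J.
have bI0 := coroot_ind_gt0 oI fI s0I; have bJ0 := coroot_ind_gt0 oJ fJ t0J.
exists s0, t0; rewrite e1 e2; rewrite e1 e2 in lt.
suff [M1 ->] : (1 < fmx I J)%N /\
    cosl R (fmx I J) ^+ 2 * (coroot s0 (ind (val I)) * coroot t0 (ind (val J))) =
    - cosl R (max_entry m (val I) (val J)) *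
    - (#|nbr (val I) t0|%:R * cosl R (max_entry m (val I) (val J))) by split.
rewrite /folded_matrix (negbTE IJ) (asboolT fIJ) /= !foldE // (negbTE mu2).
have lowI : (2 < max_entry m (val I) (val I))%N -> 1/2 <= cosl R (max_entry m (val I) (val I)).
  by move=> h; apply: cosl_ge_half; case: max_entry h => [|[|[]]].
have lowJ : (2 < max_entry m (val J) (val J))%N -> 1/2 <= cosl R (max_entry m (val J) (val J)).
  by move=> h; apply: cosl_ge_half; case: max_entry h => [|[|[]]].
have small n : (2 < n)%N -> 1/4 < 1 - cosl R n -> n = 3%N \/ n = 4%N.
  move=> n3 h; have [n5|] := leqP 5 n; first by exfalso; have := cosl_ge5 R n5; lra.
  by move: n3; case: n {h} => [|[|[|[|[|n]]]]] //; [left|right].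
move: (max_entry m (val I) (val J)) mu3 {mu1 mu2 fold e1 e2 foldE} cmu cmu3 cmu4 lt => mu mu3.
have [x ex] : exists x : R, cosl R mu = x by exists (cosl R mu).
rewrite ex => cmu cmu3 cmu4 lt.
move: #|nbr (val I) t0| cc b0 lt => b cc b0 lt.
(* Because b/4 <= b cos^2(pi/mu) < 1. *)
have b4 : (b < 4)%N.
  rewrite -(ltr_nat R); have : b%:R * x ^+ 2 < 1.
    have : coroot s0 (ind (val I)) * coroot t0 (ind (val J)) <= 1 by nra.
    by move: lt; rewrite mulrNN; lra.
  have : 0 <= (b%:R : R) by rewrite ler0n.
  by nra.
case: b cc b0 b4 lt => [|[|[|[|b]]]] // cc _ _ lt.
- rewrite !andbF /=.
  move: cc; rewrite mul1n => cc; rewrite mul1r mulrNN in lt *.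
  case: iI => [[aI [vI cardI]]|[aI [vI cardI]]];
    case: iJ => [[aJ [vJ cardJ]]|[aJ [vJ cardJ]]]; rewrite vI vJ in lt *.
  + have -> : ((max_entry m (val I) (val I), max_entry m (val J) (val J)) \in
      [:: (4%N, 2%N); (2%N, 4%N)]) = false.
      by rewrite !inE !xpair_eqE; move: aI aJ; do 2!case: max_entry => [|[|[]]].
    have -> : ((max_entry m (val I) (val I), max_entry m (val J) (val J)) \in
      [:: (3%N, 2%N); (2%N, 3%N)]) = false.
      by rewrite !inE !xpair_eqE; move: aI aJ; do 2!case: max_entry => [|[|[]]].
    by rewrite !andbF mu3 aI aJ /= (ltnW mu3) ex !mulr1.
  (* Only J has inner edges, and I, having as many elements, has maximal entry 2. Then cos^2(pi/mu)
     < 1/2 forces mu = 3, and 1/4 < 1 - cos(pi/n) leaves inner label n = 3 or 4, giving M = 4 or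
     8. *)
  + rewrite cardI ?cc //.
    have x1 : x ^+ 2 < 1 - cosl R (max_entry m (val J) (val J)) by lra.
    have lJ := lowJ aJ.
    have m3 : mu = 3%N by apply/eqP/negPn/negP => /cmu4; lra.
    have xx := cmu3 m3; rewrite m3.
    have q4 : 1/4 < 1 - cosl R (max_entry m (val J) (val J)) by move: x1; rewrite xx; lra.
    have [->|->] := small _ aJ q4.
    * by rewrite !inE !xpair_eqE /=; rewrite cosl3; have := cosl4 R; rewrite xx; split=> //; nra.
    * rewrite !inE !xpair_eqE /=; split=> //.
      by rewrite cosl8 xx; have := cosl4 R; nra.
  + rewrite cardJ -?cc //.
    have x1 : x ^+ 2 < 1 - cosl R (max_entry m (val I) (val I)) by lra.
    have lI := lowI aI.
    have m3 : mu = 3%N by apply/eqP/negPn/negP => /cmu4; lra.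
    have xx := cmu3 m3; rewrite m3.
    have q4 : 1/4 < 1 - cosl R (max_entry m (val I) (val I)) by move: x1; rewrite xx; lra.
    have [->|->] := small _ aI q4.
    * by rewrite !inE !xpair_eqE /=; rewrite cosl3; have := cosl4 R; rewrite xx; split=> //; nra.
    * rewrite !inE !xpair_eqE /=; split=> //.
      by rewrite cosl8 xx; have := cosl4 R; nra.
  (* Inner edges in both orbits would give 1/4 <= cos^2(pi/mu) < 1/4. *)
  + by exfalso; have := lowI aI; have := lowJ aJ; rewrite vI in bI0; rewrite vJ in bJ0; nra.
(* For b = 2 the label must be 3. The cross product is 2/4 = cos^2(pi/4), which leaves no room for
   inner edges. *)
- have m3 : mu = 3%N by apply/eqP/negPn/negP => /cmu4; nra.
  have xx := cmu3 m3; rewrite m3 /= in lt *; split=> //; rewrite (cosl4 R).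
  rewrite mulrNN xx in lt *.
  case: iI => [[_ [vI _]]|[aI [vI _]]];
    case: iJ => [[_ [vJ _]]|[aJ [vJ _]]]; rewrite vI vJ in lt *.
  + by lra.
  + by have := lowJ aJ; nra.
  + by have := lowI aI; nra.
  + by have := lowI aI; have := lowJ aJ; rewrite vI in bI0; rewrite vJ in bJ0; nra.
(* For b = 3 likewise, with 3/4 = cos^2(pi/6). *)
- have m3 : mu = 3%N by apply/eqP/negPn/negP => /cmu4; nra.
  have xx := cmu3 m3; rewrite m3 /= in lt *; split=> //; rewrite (cosl6 R).
  rewrite mulrNN xx in lt *.
  case: iI => [[_ [vI _]]|[aI [vI _]]];
    case: iJ => [[_ [vJ _]]|[aJ [vJ _]]]; rewrite vI vJ in lt *.
  + by lra.
  + by have := lowJ aJ; nra.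
  + by have := lowI aI; nra.
  + by have := lowI aI; have := lowJ aJ; rewrite vI in bI0; rewrite vJ in bJ0; nra.
Qed.

(** Without neighbours the orbit sums are orthogonal and M = 2. Otherwise each cross term is at
    least half a neighbour count in absolute value, so the product of the counts is below 4 and one
    of them is 1. *)
Lemma folded_angle (I J : node) : I != J ->
  finite_set (parabolic r (val I :|: val J)) -> cross_angle (val I) (val J) (fmx I J).
Proof.
move=> IJ fIJ; have oI := node_orbit I; have oJ := node_orbit J.
have fI := node_finite I; have fJ := node_finite J.
have vIJ : val I != val J by [].
have [s0 s0I] := orbit_nonempty oI; have [t0 t0J] := orbit_nonempty oJ.
have [a0|a0] := eqVneq #|nbr (val J) s0| 0%N.
  have m2 s t : s \in val I -> t \in val J -> m s t = 2%N.
    move=> sI tJ; move: a0; rewrite (card_nbr oI oJ s0I sI) => /cards0_eq /setP/(_ t).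
    by rewrite !inE tJ label_sym => /negbFE/eqP.
  have me : max_entry m (val I) (val J) = 2%N.
    apply/eqP; rewrite eqn_leq -{2}(m2 s0 t0) // max_entry_ge // andbT.
    by apply: max_entry_le => s t sI tJ; rewrite m2.
  exists s0, t0; rewrite /folded_matrix (negbTE IJ) (asboolT fIJ) me /=; split=> //.
  by rewrite (coroot_nbr (val J) s0) (cards0_eq a0) big_set0 cosl2 expr0n !mul0r.
have b0 : #|nbr (val I) t0| != 0%N.
  move: a0; rewrite -lt0n => /card_gt0P[t]; rewrite inE => /andP[tJ ts].
  rewrite (card_nbr oJ oI t0J tJ) -lt0n; apply/card_gt0P; exists s0.
  by rewrite inE s0I label_sym.
have low (K L : {set T}) s : orbit_set K -> orbit_set L -> K != L -> s \in K ->
    #|nbr L s|%:R / 2 <= - coroot s (ind L).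
  move=> oK oL KL sK; rewrite coroot_nbr -sumrN mulr_natl -sumr_const.
  apply: ler_sum => t; rewrite inE => /andP[tL t2]; rewrite opprK.
  have ts : t != s by apply: contraTneq tL => ->; exact: (orbits_disjoint oK oL KL sK).
  by have := cosl_ge_half R (label_offdiag ts) t2; lra.
have hs := low _ _ s0 oI oJ vIJ s0I.
have ht := low _ _ t0 oJ oI; rewrite eq_sym in ht; have {}ht := ht vIJ t0J.
have lt := cross_lt oI oJ fI s0I t0J vIJ fIJ.
have bI1 := coroot_le1 oI fI s0I; have bJ1 := coroot_le1 oJ fJ t0J.
have bI0 := coroot_ind_gt0 oI fI s0I; have bJ0 := coroot_ind_gt0 oJ fJ t0J.
have ab : (#|nbr (val J) s0| * #|nbr (val I) t0| < 4)%N.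
  rewrite -(ltr_nat R) natrM.
  have : 0 <= #|nbr (val J) s0|%:R :> R by rewrite ler0n.
  have : 0 <= #|nbr (val I) t0|%:R :> R by rewrite ler0n.
  have lt1 : coroot s0 (ind (val J)) * coroot t0 (ind (val I)) < 1.
    by apply: lt_le_trans lt _; rewrite -(mulr1 1) ler_pM // ltW.
  move: hs ht lt1; clear.
  move: #|_|%:R #|_|%:R (coroot _ _) (coroot _ _) => a b x y; nra.
have [|a1] := leqP 2 #|nbr (val J) s0|; last first.
  apply: one_nbr_angle IJ fIJ s0I _.
  by apply/eqP; rewrite eqn_leq -ltnS a1 lt0n.
have [b2 a2|b1 _] := leqP 2 #|nbr (val I) t0|.
  by have := leq_mul a2 b2; rewrite leqNgt ab.
apply: cross_angleC; rewrite folded_matrixC; apply: (one_nbr_angle _ _ t0J).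
- by rewrite eq_sym.
- by rewrite finset.setUC.
- by apply/eqP; rewrite eqn_leq -ltnS b1 lt0n.
Qed.

Lemma folded_relations : coxeter_relations fmx (fun I : node => longest r (val I)).
Proof.
move=> I J; have [<-|IJ] := eqVneq I J.
  by rewrite folded_matrix_diag expg1 longest_sq //; exact: node_finite.
have [fIJ|nfin] := pselect (finite_set (parabolic r (val I :|: val J))); last first.
  by rewrite /folded_matrix (negbTE IJ) (asboolF nfin).
apply: longest_rotation (folded_angle IJ fIJ) => //;
  by [exact: node_orbit | exact: node_finite].
Qed.

Local Notation nw := (word_prod (fun I : node => longest r (val I))).

(** * Reduced words in the folded generators *)

Definition node_len (c : seq node) : nat := (\sum_(I <- c) len (longest r (val I)))%N.
Definition node_reduced (c : seq node) := len (nw c) = node_len c.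

Lemma node_len_cons (I : node) (c : seq node) : node_len (I :: c) = (len (longest r (val I)) + node_len c)%N.
Proof. exact: big_cons. Qed.

Lemma node_len_ge (c : seq node) : (len (nw c) <= node_len c)%N.
Proof.
elim: c => [|I c IH]; first by rewrite word_nil len1.
by rewrite word_cons node_len_cons (leq_trans (len_mul _ _)) // leq_add2l.
Qed.

Lemma node_reduced_behead (I : node) (c : seq node) : node_reduced (I :: c) -> node_reduced c.
Proof.
rewrite /node_reduced word_cons node_len_cons => e.
have h := len_mul (longest r (val I)) (nw c); rewrite e leq_add2l in h.
by apply/eqP; rewrite eqn_leq node_len_ge.
Qed.

Lemma node_longest_gt0 (I : node) : (0 < len (longest r (val I)))%N.
Proof.
have [s sI] := orbit_nonempty (node_orbit I).
exact: (longest_neq1 (node_finite I) sI).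
Qed.

Lemma tau_node (I : node) : tau (longest r (val I)) = longest r (val I).
Proof.
apply: tau_longest; first exact: node_finite.
by move=> s; apply: orbit_p; exact: node_orbit.
Qed.

Lemma tau_nw (c : seq node) : tau (nw c) = nw c.
Proof.
by elim: c => [|I c IH]; rewrite ?word_nil ?morph1 // word_cons gmulfM tau_node IH.
Qed.

Lemma node_reduced_cons (I : node) (c : seq node) : node_reduced c ->
  (forall s, s \in val I -> ~~ desc s (nw c)) -> node_reduced (I :: c).
Proof.
rewrite /node_reduced word_cons node_len_cons => <- nd.
by apply: len_parab_min nd (longest_in _); exact: node_finite.
Qed.

Lemma node_reduced_desc (I : node) (c : seq node) s : node_reduced (I :: c) -> s \in val I ->
  desc s (nw (I :: c)).
Proof.
move=> red sI; have redc := node_reduced_behead red.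
rewrite /desc red word_cons mulgA (leq_ltn_trans (len_mul _ _)) //.
by rewrite node_len_cons redc ltn_add2r; exact: (longest_desc (node_finite I) sI).
Qed.

Lemma node_desc (I : node) w : tau w = w -> (exists2 s, s \in val I & desc s w) ->
  forall s, s \in val I -> desc s w.
Proof.
move=> tw [t tI dt] s sI; exact: orbit_desc (node_orbit I) tw tI sI dt.
Qed.

Lemma len_node_desc (I : node) w : (forall s, s \in val I -> desc s w) ->
  len w = (len (longest r (val I)) + len (longest r (val I) * w)%g)%N.
Proof. by move=> h; apply: len_longest_desc h; exact: node_finite. Qed.

(** A descent of a fixed w brings its whole orbit, which therefore generates a finite subgroup and
    is a node; its longest element is split off with additive lengths. This gives surjectivity onto
    the fixed subgroup. *)
Lemma fixed_reduced_word w : tau w = w -> exists2 c : seq node, node_reduced c & nw c = w.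
Proof.
move: {2}(len w) (leqnn (len w)) => n; elim: n w => [|n IH] w lw tw.
  exists [::]; first by rewrite /node_reduced word_nil len1 /node_len big_nil.
  by rewrite word_nil; apply/esym/len_eq0/eqP; rewrite -leqn0.
have [->|/desc_ex[s ds]] := eqVneq w 1%g.
  by exists [::]; rewrite ?word_nil // /node_reduced word_nil len1 /node_len big_nil.
have oI : orbit_set (tau_orbit r tau s) by exists s.
have sI : s \in tau_orbit r tau s by rewrite tau_orbitE.
have dI t : t \in tau_orbit r tau s -> desc t w.
  by move=> tI; exact: orbit_desc oI tw sI tI ds.
have fin : finite_orbit r tau (tau_orbit r tau s).
  apply/andP; split; first by apply/existsP; exists s.
  by apply/asboolP; exact: desc_parab_finite dI.
pose I : node := Sub (tau_orbit r tau s) fin.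
have eI : val I = tau_orbit r tau s by [].
have el := @len_node_desc I w dI.
pose w' := (longest r (val I) * w)%g.
have ew : (longest r (val I) * w' = w)%g by rewrite /w' mulgA longest_sq ?mul1g //; exact: node_finite.
have tw' : tau w' = w' by rewrite gmulfM tau_node tw.
have lw' : (len w' <= n)%N.
  by move: lw; rewrite el -/w'; have := node_longest_gt0 I; case: (len _) => // k _; rewrite addSn ltnS => /(leq_trans (leq_addl _ _)).
have [c red ec] := IH w' lw' tw'; exists (I :: c); last by rewrite word_cons ec.
by rewrite /node_reduced word_cons node_len_cons ec ew el -red ec.
Qed.

Lemma alt_node_reduced (I J : node) n : I != J ->
  finite_set (parabolic r (val I :|: val J)) -> (n <= fmx I J)%N ->
  node_reduced (alt_word I J n).
Proof.
elim: n I J => [|n IH] I J IJ fIJ hn.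
  by rewrite /node_reduced word_nil len1 /node_len big_nil.
apply: node_reduced_cons => [|s sI].
  apply: IH; first by rewrite eq_sym.
    by rewrite finset.setUC.
  by rewrite folded_matrixC ltnW.
rewrite word_alt.
exact: (alt_longest_ndesc (node_orbit I) (node_orbit J) (node_finite I) (node_finite J)
  IJ (folded_angle IJ fIJ) hn sI).
Qed.

(** * Comparison of words in the folded Coxeter group *)

Section FoldedPresentation.
Variables (W' : groupType) (g : node -> W').
Hypothesis pres' : coxeter_group fmx g.
Local Notation ev' := (word_prod g).

Lemma node_gen_sq I : (g I * g I = 1)%g.
Proof. by case: pres' => /(_ I I); rewrite folded_matrix_diag. Qed.

Lemma reduced_words_eq (c d : seq node) : node_reduced c -> node_reduced d -> nw c = nw d ->
  ev' c = ev' d.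
Proof.
move: {2}(len (nw c)) (leqnn (len (nw c))) => n; elim: n c d => [|n IH] c d lc0 rc rd e.
  have nil u : node_reduced u -> nw u = nw c -> u = [::].
    case: u => // I u ru eu; move: lc0; rewrite -eu ru node_len_cons leqn0 addn_eq0.
    by have := node_longest_gt0 I; case: (len _).
  by rewrite (nil d rd (esym e)) (nil c rc erefl).
have lt I u : node_reduced (I :: u) -> nw (I :: u) = nw c -> (len (nw u) <= n)%N.
  move=> ru eu; move: lc0; rewrite -eu ru node_len_cons (node_reduced_behead ru).
  have := node_longest_gt0 I; case: (len _) => // k _.
  by rewrite addSn ltnS => /(leq_trans (leq_addl _ _)).
case: c d lc0 rc rd e lt => [|I c] [|J d] lc0 rc rd e lt //.
- have := congr1 len e; rewrite word_nil len1 rd node_len_cons.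
  by have := node_longest_gt0 J; case: (len _).
- have := congr1 len e; rewrite word_nil len1 rc node_len_cons.
  by have := node_longest_gt0 I; case: (len _).
have lic := lt I c rc erefl; have ljd := lt J d rd (esym e).
have rc' := node_reduced_behead rc; have rd' := node_reduced_behead rd.
have [IJ|IJ] := eqVneq I J.
  rewrite -IJ !word_cons in e *; congr (_ * _)%g; apply: IH => //.
  exact: mulgI e.
pose K := val I :|: val J; pose w := nw (I :: c).
have dK s : s \in K -> desc s w.
  rewrite finset.in_setU => /orP[sI|sJ]; first exact: node_reduced_desc.
  by rewrite /w e; exact: node_reduced_desc.
have fK : finite_set (parabolic r K) by exact: desc_parab_finite dK.
have fK' : finite_set (parabolic r (val J :|: val I)) by rewrite finset.setUC.
have JI : J != I by rewrite eq_sym.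
pose M := fmx I J.
have M0 : M = M.-1.+1.
  by case: (folded_angle IJ fK) => s [t [_ _ + _]]; rewrite -/M; case: (M).
have rI := alt_node_reduced IJ fK (leqnn _); have rJ := alt_node_reduced JI fK' (leqnn _).
rewrite -/M in rI; rewrite (folded_matrixC J I) -/M in rJ.
have eIJ : nw (alt_word I J M) = nw (alt_word J I M).
  rewrite !word_alt; apply: alt_braid; rewrite ?longest_sq //; try exact: node_finite.
  exact: folded_relations.
have xK : nw (alt_word I J M) = longest r K.
  apply: (longest_unique fK).
    rewrite word_alt; move: (M) => k.
    have hI : in_parab K (longest r (val I)).
      exact: in_parabS (finset.subsetUl _ _) (longest_in (node_finite I)).
    have hJ : in_parab K (longest r (val J)).
      exact: in_parabS (finset.subsetUr _ _) (longest_in (node_finite J)).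
    elim: k (longest r (val I)) (longest r (val J)) hI hJ => [|k IHk] a b ha hb /=.
      exact: in_parab1.
    exact: (in_parabM ha (IHk _ _ hb ha)).
  move=> s; rewrite finset.in_setU => /orP[sI|sJ].
    by move: rI; rewrite M0 => rI; exact: node_reduced_desc.
  by rewrite eIJ; move: rJ; rewrite M0 => rJ; exact: node_reduced_desc.
pose v := (longest r K * w)%g.
have ew : (longest r K * v = w)%g by rewrite /v mulgA longest_sq ?mul1g.
have tv : tau v = v by rewrite /v gmulfM -xK /w !tau_nw.
have el : len w = (len (longest r K) + len v)%N by exact: len_longest_desc dK.
(* A common tail: [u] completes both alternating words to length-additive words for [w]. *)
have [u ru eu] := fixed_reduced_word tv.
have redA A : node_reduced A -> nw A = longest r K -> node_reduced (A ++ u).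
  move=> rA eA; rewrite /node_reduced word_cat eA eu ew el -eA rA -eu ru.
  by rewrite /node_len big_cat.
have evA A : nw A = longest r K -> nw (A ++ u) = w by move=> eA; rewrite word_cat eA eu ew.
(* Both words begin with [X], so the induction hypothesis applies after cancelling it; the two
   alternating words are then exchanged by the relation of the folded group. *)
have tail (X Y : node) b : node_reduced (X :: b) -> nw (X :: b) = w ->
    node_reduced (alt_word X Y M) -> nw (alt_word X Y M) = longest r K ->
    ev' (X :: b) = ev' (alt_word X Y M ++ u).
  move=> rb eb rA eA; have r2 := redA _ rA eA; have e2 := evA _ eA.
  move: r2 e2; rewrite M0 /= => r2 e2; rewrite !word_cons; congr (_ * _)%g.
  apply: IH.
  - exact: lt rb eb.
  - exact: node_reduced_behead rb.
  - exact: node_reduced_behead r2.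
  - by move: eb; rewrite -e2 !word_cons => /mulgI.
rewrite (tail I J c rc erefl rI xK) (tail J I d rd (esym e) rJ) -?eIJ // !word_cat.
congr (_ * _)%g; rewrite !word_alt; apply: alt_braid; rewrite ?node_gen_sq //.
by case: pres' => rel _; exact: rel.
Qed.

(** Letters are prefixed one at a time. If the new letter does not lengthen the word,
    [reduced_words_eq] rewrites the word to start with that letter, and the two copies cancel. *)
Lemma node_words_reduced (x : W') : exists2 c : seq node, node_reduced c & ev' c = x.
Proof.
have [c <-] := pres_words pres' node_gen_sq x; elim: c => [|I c [d rd ed]].
  by exists [::]; rewrite ?word_nil // /node_reduced word_nil len1 /node_len big_nil.
rewrite word_cons -ed.
have [[s sI ds]|nd] := pselect (exists2 s, s \in val I & desc s (nw d)); last first.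
  exists (I :: d); last by rewrite word_cons.
  by apply: node_reduced_cons => // s sI; apply/negP => ds; apply: nd; exists s.
have dI := node_desc (tau_nw d) (ex_intro2 _ _ s sI ds).
pose w := (longest r (val I) * nw d)%g.
have ew : (longest r (val I) * w = nw d)%g.
  by rewrite /w mulgA longest_sq ?mul1g //; exact: node_finite.
have tw : tau w = w by rewrite gmulfM tau_node tau_nw.
have [b rb eb] := fixed_reduced_word tw; exists b => //.
have rIb : node_reduced (I :: b).
  by rewrite /node_reduced word_cons eb ew node_len_cons (len_node_desc dI) -/w -rb eb.
rewrite (reduced_words_eq rd rIb); last by rewrite word_cons eb ew.
by rewrite word_cons mulgA node_gen_sq mul1g.
Qed.

Lemma folding_isomorphism (lambda : {multiplicative W' -> W}) :
  (forall I, lambda (g I) = longest r (val I)) ->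
  injective lambda /\ range lambda = [set w | tau w = w]%classic.
Proof.
move=> lg; have le (c : seq node) : lambda (ev' c) = nw c.
  by elim: c => [|I c IH]; rewrite ?word_nil ?morph1 // !word_cons gmulfM lg IH.
split.
  move=> x y; have [c rc <-] := node_words_reduced x; have [d rd <-] := node_words_reduced y.
  by rewrite !le => /(reduced_words_eq rc rd).
apply/seteqP; split=> [_ [x _ <-]|w /= tw].
  by have [c _ <-] := node_words_reduced x; rewrite /= le tau_nw.
by have [c _ <-] := fixed_reduced_word tw; exists (ev' c).
Qed.

End FoldedPresentation.

End Twisted.

End CoxeterTheory.

Local Open Scope classical_set_scope.

Theorem theoremA8 (T : finType) (m : T -> T -> nat) (W : groupType) (r : T -> W)
    (tau : {multiplicative W -> W})
    (W' : groupType) (g : folded_node r tau -> W') :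
  coxeter_matrix m ->
  coxeter_group m r ->
  bijective tau ->
  tau @` range r = range r ->
  coxeter_group (@folded_matrix T W r tau m) g ->
  exists lambda : {multiplicative W' -> W},
    [/\ forall I : folded_node r tau, lambda (g I) = longest r (val I),
        forall lambda' : {multiplicative W' -> W},
          (forall I : folded_node r tau, lambda' (g I) = longest r (val I)) ->
          lambda' =1 lambda,
        injective lambda &
        range lambda = [set w | tau w = w]].
Proof.
move=> hm pres /bij_inj tau_inj tau_range pres'.
have [act hact] := geometric_action_exists Rdefinitions.R hm pres.
have p_ex s : exists t, tau (r s) = r t.
  have : (tau @` range r) (tau (r s)) by exists (r s) => //; exists s.
  by rewrite tau_range => -[t _ <-]; exists t.
(* The permutation of the simple reflections is lifted to a map of their indices. *)
have [p tau_gen] := choice p_ex.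
have rel := folded_relations hm pres hact tau_inj tau_gen.
have [lambda [lambdaE lambda_uniq]] := pres'.2 W _ rel.
have [inj im] := folding_isomorphism hm pres hact tau_inj tau_gen pres' lambdaE.
by exists lambda.
Qed.
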